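(* Let $n\geq 1$ and let $f\colon (\mathbb{C}^n,0)\to (\mathbb{C}^{n+1},0)$ be a finite holomorphic map germ of corank $1$. Write the coordinates of $\mathbb{C}^n$ as $(x,y)$ with $x=(x_1,\dots,x_{n-1})\in\mathbb{C}^{n-1}$ and $y\in\mathbb{C}$. Then $f$ is $\mathcal{A}$-equivalent to a finite map germ $F\colon(\mathbb{C}^n,0)\to(\mathbb{C}^{n+1},0)$ of the form $$F(x,y)=(x_1,\dots,x_{n-1},\,y^m+g(x,y),\,h(x,y)),$$ for some positive integer $m$ and holomorphic function germs $g,h$, such that $\operatorname{mult} F=\operatorname{gd}(F)$.
   Context: A map germ $f$ is finite if $f^{-1}(0)=\{0\}$ as germs. The corank of $f$ is $n-\operatorname{rank} df_0$. Two holomorphic map germs $f,F\colon(\mathbb{C}^n,0)\to(\mathbb{C}^{p},0)$ are $\mathcal{A}$-equivalent if there exist germs of biholomorphisms $\phi\colon(\mathbb{C}^n,0)\to(\mathbb{C}^n,0)$ and $\varphi\colon(\mathbb{C}^p,0)\to(\mathbb{C}^p,0)$ such that $F=\varphi\circ f\circ\phi^{-1}$. Let $\mathcal{O}_n$ be the ring of holomorphic function germs on $(\mathbb{C}^n,0)$. The multiplicity of a finite map germ $F$ is $\operatorname{mult} F=\dim_{\mathbb{C}}\mathcal{O}_n/\langle F\rangle$, where $\langle F\rangle$ is the ideal generated by the coordinate functions of $F$. The generic degree $\operatorname{gd}(F)$ is the minimum of $\dim_{\mathbb{C}}\mathcal{O}_n/\langle \pi\circ F\rangle$ over all linear projections $\pi\colon\mathbb{C}^{n+1}\to\mathbb{C}^n$.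 *)

(* Defs.v *)
From HB Require Import structures.
From mathcomp Require Import all_boot all_order all_algebra complex.
From mathcomp Require Import all_classical all_reals all_analysis.

Set Implicit Arguments.
Unset Strict Implicit.
Unset Printing Implicit Defensive.

Import Order.TTheory GRing.Theory Num.Theory.
Import numFieldNormedType.Exports.

Local Open Scope classical_set_scope.
Local Open Scope ring_scope.

(* The complex numbers R[i], named as a [numClosedFieldType] so that they get
   the norm topology that [numFieldNormedType] puts on an abstract field; the
   bare type [R[i]] carries no topology in the library. *)
Definition Cx (R : realType) : numClosedFieldType := R[i].

Section MapGerms.
Variable R : realType.
Local Notation C := (Cx R).

(* Germs at 0 are represented by total functions, of which only the behaviour
   near 0 matters; equality of germs is equality near 0.  [differentiable] is
   Frechet differentiability over the base field, here C. *)
Definition holomorphic_germ n (W : normedModType C) (f : 'rV[C]_n -> W) :=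
  \forall z \near (0 : 'rV[C]_n), differentiable f z.

Definition map_germ n p (f : 'rV[C]_n -> 'rV[C]_p) :=
  holomorphic_germ f /\ f 0 = 0.

Definition finite_germ n p (f : 'rV[C]_n -> 'rV[C]_p) :=
  \forall z \near (0 : 'rV[C]_n), f z = 0 <-> z = 0.

Definition corank n p (f : 'rV[C]_n -> 'rV[C]_p) : nat :=
  (n - \rank ('J f (0 : 'rV[C]_n)%R))%N.

Definition biholomorphic_germ n (phi phi' : 'rV[C]_n -> 'rV[C]_n) :=
  [/\ map_germ phi, map_germ phi',
      \forall z \near (0 : 'rV[C]_n), phi' (phi z) = z &
      \forall z \near (0 : 'rV[C]_n), phi (phi' z) = z].

Definition A_equivalent n p (f F : 'rV[C]_n -> 'rV[C]_p) :=
  exists (phi phi' : 'rV[C]_n -> 'rV[C]_n) (psi psi' : 'rV[C]_p -> 'rV[C]_p),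
  [/\ biholomorphic_germ phi phi', biholomorphic_germ psi psi' &
      \forall z \near (0 : 'rV[C]_n), F z = psi (f (phi' z))].

(* The germ of [a] lies in the ideal <G> of O_n. *)
Definition in_ideal n p (G : 'rV[C]_n -> 'rV[C]_p) (a : 'rV[C]_n -> C) :=
  exists c : 'I_p -> 'rV[C]_n -> C,
    (forall j, holomorphic_germ (c j)) /\
    \forall z \near (0 : 'rV[C]_n), a z = \sum_j c j z * G z 0 j.

(* dim_C (O_n / <G>) = d : the classes of some e_0, ..., e_(d-1) in O_n form a
   basis of O_n / <G>.  If the dimension is infinite, no d qualifies. *)
Definition quotient_dim n p (G : 'rV[C]_n -> 'rV[C]_p) (d : nat) :=
  exists e : 'I_d -> 'rV[C]_n -> C,
  [/\ forall i, holomorphic_germ (e i),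
      forall a : 'rV[C]_n -> C, holomorphic_germ a ->
        exists lam : 'I_d -> C,
          in_ideal G (fun z => a z - \sum_i lam i * e i z) &
      forall lam : 'I_d -> C,
        in_ideal G (fun z => \sum_i lam i * e i z) -> forall i, lam i = 0].

Definition multiplicity n p (F : 'rV[C]_n -> 'rV[C]_p) (d : nat) :=
  quotient_dim F d.

(* A linear projection C^(n+1) -> C^n is a surjective linear map, given by a
   matrix of rank n acting on row vectors.  Projections with an
   infinite-dimensional quotient do not affect the minimum. *)
Definition generic_degree n (F : 'rV[C]_n -> 'rV[C]_n.+1) (d : nat) :=
  (exists P : 'M[C]_(n.+1, n),
     \rank P = n /\ quotient_dim (fun z => F z *m P) d) /\
  (forall (P : 'M[C]_(n.+1, n)) (d' : nat),
     \rank P = n -> quotient_dim (fun z => F z *m P) d' -> (d <= d')%N).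

(* (x_1, ..., x_n, y) |-> (x_1, ..., x_n, y^m + g(x,y), h(x,y)), the last
   coordinate [z 0 ord_max] of z being y. *)
Definition normal_form n (m : nat) (g h : 'rV[C]_n.+1 -> C)
    (z : 'rV[C]_n.+1) : 'rV[C]_n.+2 :=
  \row_(j < n.+2)
    if (j < n)%N then z 0 (inord j)
    else if j == n :> nat then z 0 ord_max ^+ m + g z
    else h z.

End MapGerms.

(* Main.v *)
Require Import Defs.
From HB Require Import structures.
From mathcomp Require Import all_boot all_order all_algebra complex ring lra.
From mathcomp Require Import fingroup perm.
From mathcomp Require Import all_classical all_reals all_analysis.

Import Order.TTheory GRing.Theory Num.Theory.
Import numFieldNormedType.Exports.

Local Open Scope classical_set_scope.
Local Open Scope ring_scope.

Set Implicit Arguments.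
Unset Strict Implicit.
Unset Printing Implicit Defensive.

(** The idea.  The Jacobian of f at 0 has rank n, so after linear changes of
    coordinates the first n components of f have linear parts x_1, ..., x_n.
    Together with y they form a local biholomorphism, and composing f with its
    inverse gives a map (x, p(x,y), q(x,y)).  Since f is finite, p(0,y) and
    q(0,y) are not both identically zero; after exchanging them if necessary,
    p(0,y) = y^m * unit and y^m divides q(0,y).  Put g = p - y^m and h = q.

    By Hadamard's lemma every germ is, modulo x, a function of y alone, and
    modulo p it becomes a polynomial in y of degree less than m.  So the powers
    1, y, ..., y^(m-1) span O/<x,p>, and a fortiori O/<F>; they are independent
    modulo <F>, because on the y-axis every element of <F> is a multiple of y^m.
    Hence both quotients have dimension m.  The first is the one attached to the
    projection that forgets the last component, and no projection can give less
    than m, since <pi o F> is contained in <F>.  The lemmas that carry this part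
    are [straighten], [choose_order], [normal_form_span], [normal_form_free] and
    [quotient_dim_ge].

    The analysis.  A holomorphic germ is only assumed to be complex
    differentiable at each point near 0; the continuity of its differential and
    all the division properties used above have to be derived.  Everything rests
    on Cauchy's estimate for the derivative ([cauchy_estimate]).  It is obtained
    from Goursat's bisection argument applied to Riemann sums along the boundary
    of a parallelogram instead of integrals: such sums are exactly additive under
    subdivision and vanish exactly on affine functions ([goursat]).  In the
    variable s, with w = exp s, the boundary of an annulus becomes that of a
    rectangle with two sides identified, which makes the mean of
    (f(w) - f(0)) / w over a circle independent of the radius.

    Restricting to complex lines gives, in any dimension, a quadratic bound for
    the first order Taylor remainder with a constant depending only on a bound
    of the function ([taylor1_bound]), so a uniform limit of holomorphic functions
    is holomorphic ([uniform_limit_differentiable]).  This closure property yields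
    the two tools of the first part: the quotient of an increment by a coordinate
    is a limit of means of a partial derivative ([divided_differentiable], hence
    [hadamard] and, in one variable, Taylor expansions), and a local inverse is a
    limit of Picard iterates ([inverse_function]). *)

(** * Real-valued norms and limits over C *)

Section RealNorm.
Variable R : realType.
Local Notation C := (Cx R).

Definition rc (x : R) : C := (x%:C)%C.

Lemma rc_le (x y : R) : (rc x <= rc y) = (x <= y). Proof. exact: lecR. Qed.
Lemma rc_lt (x y : R) : (rc x < rc y) = (x < y). Proof. exact: ltcR. Qed.
Lemma rcD (x y : R) : rc (x + y) = rc x + rc y.
Proof. exact: (rmorphD (real_complex R)). Qed.
Lemma rcM (x y : R) : rc (x * y) = rc x * rc y.
Proof. exact: (rmorphM (real_complex R)). Qed.
Lemma rcB (x y : R) : rc (x - y) = rc x - rc y.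
Proof. exact: (rmorphB (real_complex R)). Qed.
Lemma rcV (x : R) : rc x^-1 = (rc x)^-1.
Proof. exact: (fmorphV (real_complex R)). Qed.
Lemma rc0 : rc 0 = 0. Proof. by []. Qed.
Lemma rc1 : rc 1 = 1. Proof. by []. Qed.
Lemma rc_nat (n : nat) : rc n%:R = n%:R.
Proof. exact: (rmorph_nat (real_complex R)). Qed.
Lemma rcX (x : R) n : rc (x ^+ n) = rc x ^+ n.
Proof. exact: (rmorphXn (real_complex R)). Qed.
Lemma rc_eq0 (x : R) : (rc x == 0) = (x == 0).
Proof. by rewrite -rc0 eq_complex /= eqxx andbT. Qed.
Lemma rc_pos (e : C) : 0 < e -> exists2 r : R, 0 < r & e = rc r.
Proof.
move=> e0; exists (complex.Re e); last by rewrite /rc RRe_real // ger0_real // ltW.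
by rewrite -rc_lt /rc RRe_real // ger0_real // ltW.
Qed.

(** Norms over C take values in C, whose order is only partial; the estimates
    are carried out in R. *)
Definition rnorm (V : normedModType C) (x : V) : R := complex.Re `|x|.

Lemma rnormE (V : normedModType C) (x : V) : `|x| = rc (rnorm x).
Proof. by rewrite /rc /rnorm RRe_real // normr_real. Qed.

Section Theory.
Variable V : normedModType C.
Implicit Types x y : V.

Lemma rnorm_ge0 x : 0 <= rnorm x.
Proof. by rewrite -rc_le -rnormE normr_ge0. Qed.
Lemma rnormD x y : rnorm (x + y) <= rnorm x + rnorm y.
Proof. by rewrite -rc_le rcD -!rnormE ler_normD. Qed.
Lemma rnormN x : rnorm (- x) = rnorm x.
Proof. by rewrite /rnorm normrN. Qed.
Lemma rnormB x y : rnorm (x - y) <= rnorm x + rnorm y.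
Proof. by rewrite -(rnormN y) rnormD. Qed.
Lemma rdistC x y : rnorm (x - y) = rnorm (y - x).
Proof. by rewrite /rnorm distrC. Qed.
Lemma rnorm_dist x y : rnorm x <= rnorm y + rnorm (x - y).
Proof. by rewrite -[x in leLHS](subrK y) addrC rnormD. Qed.
Lemma rdist_triangle z x y : rnorm (x - y) <= rnorm (x - z) + rnorm (z - y).
Proof. by rewrite -[x in leLHS](subrK z) -addrA rnormD. Qed.
Lemma rnorm0 : rnorm (0 : V) = 0.
Proof. by rewrite /rnorm normr0. Qed.
Lemma rnorm_eq0 x : (rnorm x == 0) = (x == 0).
Proof. by rewrite -rc_eq0 -rnormE normr_eq0. Qed.
Lemma rnorm_gt0 x : (0 < rnorm x) = (x != 0).
Proof. by rewrite lt_def rnorm_ge0 andbT rnorm_eq0. Qed.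
Lemma rnormZ (a : C) x : rnorm (a *: x) = rnorm a * rnorm x.
Proof. by apply: complexI; rewrite -/(rc _) -/(rc _) -rnormE normrZ !rnormE rcM. Qed.
Lemma rnorm_sum (I : Type) (r : seq I) (P : pred I) (F : I -> V) :
  rnorm (\sum_(i <- r | P i) F i) <= \sum_(i <- r | P i) rnorm (F i).
Proof.
elim/big_ind2 : _ => [||//]; first by rewrite rnorm0.
by move=> x a y b xa yb; rewrite (le_trans (rnormD _ _)) // lerD.
Qed.
Lemma rnorm_small x : (forall e : R, 0 < e -> rnorm x <= e) -> x = 0.
Proof.
move=> h; apply/eqP; rewrite -rnorm_eq0 eq_le rnorm_ge0 andbT.
by apply/ler_addgt0Pl => e /h; rewrite addr0.
Qed.

Lemma nbhs_rnormP (z : V) (P : set V) :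
  nbhs z P <-> exists2 d : R, 0 < d & forall w, rnorm (w - z) < d -> P w.
Proof.
split=> [/nbhs_normP[e /= e0 eP]|[d d0 dP]].
  have [r r0 er] := rc_pos e0; exists r => // w wz; apply: eP => /=.
  by rewrite distrC rnormE er rc_lt.
apply/nbhs_normP; exists (rc d) => /=; first by rewrite rc_lt.
by move=> w /=; rewrite distrC rnormE rc_lt => /dP.
Qed.

Lemma nbhs0_rnormP (P : set V) :
  (\forall z \near (0 : V), P z) <->
  exists2 d : R, 0 < d & forall w, rnorm w < d -> P w.
Proof.
split=> [/nbhs_rnormP[d d0 dP]|[d d0 dP]].
  by exists d => // w h; apply: dP; rewrite subr0.
by apply/nbhs_rnormP; exists d => // w; rewrite subr0 => /dP.
Qed.
End Theory.

Lemma rnormM (a b : C) : rnorm (a * b) = rnorm a * rnorm b.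
Proof. exact: (@rnormZ C a b). Qed.
Lemma rnorm1 : rnorm (1 : C) = 1.
Proof. by rewrite /rnorm normr1. Qed.
Lemma rnormV (a : C) : rnorm a^-1 = (rnorm a)^-1.
Proof. by apply: complexI; rewrite -/(rc _) -/(rc _) -rnormE normfV rnormE rcV. Qed.
Lemma rnormX (a : C) n : rnorm (a ^+ n) = rnorm a ^+ n.
Proof. by apply: complexI; rewrite -/(rc _) -/(rc _) -rnormE normrX rnormE rcX. Qed.
Lemma rnorm_rc (x : R) : rnorm (rc x) = `|x|.
Proof.
apply: complexI; rewrite -/(rc _) -/(rc _) -rnormE /rc normc_def /= expr0n addr0.
by rewrite sqrtr_sqr.
Qed.
Lemma rnorm_ge_Re (z : C) : `|complex.Re z| <= rnorm z.
Proof. by rewrite -rc_le -rnormE; exact: normc_ge_Re. Qed.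
Lemma rnorm_ge_Im (z : C) : `|complex.Im z| <= rnorm z.
Proof.
rewrite -rc_le -rnormE normc_def; case: z => a b /=; rewrite rc_le.
by rewrite -sqrtr_sqr ler_wsqrtr // lerDr sqr_ge0.
Qed.
Lemma rnorm_le_ReIm (z : C) : rnorm z <= `|complex.Re z| + `|complex.Im z|.
Proof.
rewrite -rc_le -rnormE normc_def; case: z => a b /=; rewrite rc_le.
rewrite -[leRHS]ger0_norm ?addr_ge0 // -sqrtr_sqr ler_wsqrtr // sqrrD.
by rewrite !real_normK ?num_real // -addrA lerD2l lerDr mulrn_wge0 // mulr_ge0.
Qed.

Lemma cauchy_seq_limit (u : nat -> R) :
  (forall e : R, 0 < e -> exists N, forall m n, (N <= m)%N -> (N <= n)%N ->
     `|u m - u n| <= e) ->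
  exists l, forall e : R, 0 < e -> exists N, forall n, (N <= n)%N -> `|u n - l| <= e.
Proof.
move=> h; have : cvg (u @ \oo).
  apply/cauchy_cvgP/cauchy_exP => e e0.
  have [|N hN] := h (e / 2); first by rewrite divr_gt0.
  exists (u N); exists N => // n /= Nn; rewrite -ball_normE /=.
  apply: le_lt_trans (hN _ _ (leqnn N) Nn) _.
  by rewrite ltr_pdivrMr // ltr_pMr // ltr1n.
move=> /cvgrPdist_le ul; exists (lim (u @ \oo)) => e /ul [N _ hN].
by exists N => n Nn; rewrite distrC; exact: hN.
Qed.

Lemma complex_cauchy_limit (u : nat -> C) :
  (forall e : R, 0 < e -> exists N, forall m n, (N <= m)%N -> (N <= n)%N ->
     rnorm (u m - u n) <= e) ->
  exists l, forall e : R, 0 < e ->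
    exists N, forall n, (N <= n)%N -> rnorm (u n - l) <= e.
Proof.
move=> h.
have ReB (x y : C) : complex.Re (x - y) = complex.Re x - complex.Re y.
  by case: x y => [? ?] [? ?].
have ImB (x y : C) : complex.Im (x - y) = complex.Im x - complex.Im y.
  by case: x y => [? ?] [? ?].
have [|a ha] := cauchy_seq_limit (u := fun n => complex.Re (u n)).
  move=> e /h[N hN]; exists N => m n Nm Nn /=; rewrite -ReB.
  exact: le_trans (rnorm_ge_Re _) (hN _ _ Nm Nn).
have [|b hb] := cauchy_seq_limit (u := fun n => complex.Im (u n)).
  move=> e /h[N hN]; exists N => m n Nm Nn /=; rewrite -ImB.
  exact: le_trans (rnorm_ge_Im _) (hN _ _ Nm Nn).
exists (a +i* b)%C => e e0; have e20 : 0 < e / 2 by rewrite divr_gt0.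
have [[N hN] [M hM]] := (ha _ e20, hb _ e20).
exists (maxn N M) => n; rewrite geq_max => /andP[Nn Mn].
apply: le_trans (rnorm_le_ReIm _) _; rewrite ReB ImB.
by rewrite [leRHS]splitr lerD //; [exact: hN|exact: hM].
Qed.

End RealNorm.

(** * Differentiability by estimates *)

Section Differential.
Variable R : realType.
Local Notation C := (Cx R).

(** The epsilon-delta content of differentiability, kept apart from linearity and
    continuity of L so that it can be used and produced by plain estimates. *)
Definition has_diff (V W : normedModType C) (f : V -> W) (z : V) (L : V -> W) :=
  forall e : R, 0 < e -> exists2 d : R, 0 < d &
    forall h, rnorm h < d -> rnorm (f (z + h) - f z - L h) <= e * rnorm h.

Lemma differentiable_has_diff (V W : normedModType C) (f : V -> W) z :
  differentiable f z -> has_diff f z ('d f z).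
Proof.
move=> df e e0; have /eqaddoP/(_ (rc e)) := diff_locally df.
rewrite rc_lt => /(_ e0)/nbhs0_rnormP[d d0 dP]; exists d => // h /dP /=.
rewrite !fctE /= !rnormE -rcM rc_le opprD addrA.
by rewrite [z + h]addrC.
Qed.

Lemma has_diff_differentiable (V W : normedModType C) (f : V -> W) z
    (L : {linear V -> W}) (B : R) :
  (forall h, rnorm (L h) <= B * rnorm h) -> has_diff f z L ->
  differentiable f z /\ 'd f z = L :> (V -> W).
Proof.
move=> LB fL.
have cL : continuous L.
  apply/linear_bounded_continuous/linear_boundedP.
  have B'0 : 0 < `|B| + 1 by rewrite ltr_wpDl.
  exists (rc (`|B| + 1)); split; first by rewrite ger0_real // (rc_le 0) ltW.
  move=> r Br h.
  rewrite (@le_trans _ _ (rc (`|B| + 1) * `|h|)) //.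
    rewrite !rnormE -rcM rc_le (le_trans (LB h)) // ler_wpM2r ?rnorm_ge0 //.
    by rewrite (le_trans (ler_norm B)) // lerDl.
  by rewrite ler_wpM2r // ltW.
have fo : f \o shift z = cst (f z) + L +o_0 id.
  apply/eqaddoP => _/rc_pos[e e0 ->].
  have [d d0 dP] := fL _ e0; apply/nbhs0_rnormP; exists d => // h /dP.
  by rewrite !fctE /= !rnormE -rcM rc_le opprD addrA [z + h]addrC.
have dL := diff_unique cL fo.
by split=> //; apply/diff_locallyP; rewrite dL.
Qed.

End Differential.

(** * Bisection of the unit square *)

Section Bisection.
Variable R : realType.

Lemma half_pow_gt0 k : 0 < (2^-1 : R) ^+ k.
Proof. by rewrite exprn_gt0 // invr_gt0. Qed.

Lemma half_powS k : (2^-1 : R) ^+ k = 2^-1 ^+ k.+1 + 2^-1 ^+ k.+1.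
Proof. by rewrite exprS; lra. Qed.

Lemma half_pow_small (d : R) : 0 < d -> exists k, 2^-1 ^+ k < d.
Proof.
move=> d0; exists (Num.bound d^-1).
rewrite exprVn invf_plt ?posrE ?exprn_gt0 //.
apply: lt_trans (archi_boundP _) _; first by rewrite invr_ge0 ltW.
by rewrite -natrX ltr_nat ltn_expl.
Qed.

Lemma nested_dyadic (u : nat -> R) :
  (forall k, u k <= u k.+1 <= u k + 2^-1 ^+ k.+1) ->
  exists s, forall k, u k <= s <= u k + 2^-1 ^+ k.
Proof.
move=> hu.
have lo k j : u k <= u (j + k)%N.
  by elim: j => // j IH; have /andP[h _] := hu (j + k)%N; exact: le_trans h.
have hi k j : u (j + k)%N + 2^-1 ^+ (j + k) <= u k + 2^-1 ^+ k.
  elim: j => // j IH; apply: le_trans IH; have /andP[_ h] := hu (j + k)%N.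
  by rewrite (half_powS (j + k)) addrA lerD2r.
have ub k j : u j <= u k + 2^-1 ^+ k.
  apply: le_trans (lo j k) _; rewrite addnC; apply: le_trans (hi k j).
  by rewrite lerDl ltW // half_pow_gt0.
exists (sup (range u)) => k; apply/andP; split.
  apply: ub_le_sup; last by exists k.
  by exists (u 0%N + 2^-1 ^+ 0) => _ [j _ <-]; exact: ub.
by apply: ge_sup; [exists (u 0%N), 0%N | move=> _ [j _ <-]; exact: ub].
Qed.

(** Pointwise differentiability is not uniform: the scale below which P holds
    depends on the point.  This is the form of compactness that copes with it.
    If P failed on the unit square, bisection would produce nested squares on
    which P fails, shrinking to a point, against the hypothesis at that point. *)
Lemma cousin_square (P : nat -> R -> R -> Prop) :
  (forall k s t,
     let d : R := 2^-1 ^+ k.+1 in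
     P k.+1 s t -> P k.+1 (s + d) t -> P k.+1 s (t + d) ->
     P k.+1 (s + d) (t + d) -> P k s t) ->
  (forall s t, 0 <= s <= 1 -> 0 <= t <= 1 -> exists2 d : R, 0 < d &
     forall k s' t', 2^-1 ^+ k < d -> s' <= s <= s' + 2^-1 ^+ k ->
       t' <= t <= t' + 2^-1 ^+ k -> P k s' t') ->
  P 0%N 0 0.
Proof.
move=> Psplit Ploc; apply: contrapT => nP.
have step (x : nat * (R * R)) : exists y : R * R,
    ~ P x.1 x.2.1 x.2.2 ->
    [/\ ~ P x.1.+1 y.1 y.2, x.2.1 <= y.1 <= x.2.1 + 2^-1 ^+ x.1.+1
      & x.2.2 <= y.2 <= x.2.2 + 2^-1 ^+ x.1.+1].
  case: x => k [s t] /=; set d : R := 2^-1 ^+ k.+1.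
  have d0 : 0 <= d by rewrite ltW // half_pow_gt0.
  have [ok|] := pselect (P k s t); first by exists (s, t).
  move=> nok; have [h1|] := pselect (P k.+1 s t); last first.
    by exists (s, t) => _ /=; rewrite !lexx !lerDl d0.
  have [h2|] := pselect (P k.+1 (s + d) t); last first.
    by exists (s + d, t) => _ /=; rewrite !lexx !lerDl d0.
  have [h3|] := pselect (P k.+1 s (t + d)); last first.
    by exists (s, t + d) => _ /=; rewrite !lexx !lerDl d0.
  have [h4|] := pselect (P k.+1 (s + d) (t + d)); last first.
    by exists (s + d, t + d) => _ /=; rewrite !lexx !lerDl d0.
  by case: nok; exact: Psplit h1 h2 h3 h4.
have [next nextP] := choice step.
pose q := fix q k := if k is j.+1 then next (j, q j) else (0, 0).
have nPq k : ~ P k (q k).1 (q k).2.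
  by elim: k => [//|k IH]; have [] := nextP (k, q k) IH.
have [|s hs] := @nested_dyadic (fun k => (q k).1).
  by move=> k; have [_ ->] := nextP (k, q k) (nPq k).
have [|t ht] := @nested_dyadic (fun k => (q k).2).
  by move=> k; have [_ _ ->] := nextP (k, q k) (nPq k).
have [||d d0 dP] := Ploc s t.
- by have := hs 0%N; rewrite /= expr0 add0r.
- by have := ht 0%N; rewrite /= expr0 add0r.
by have [k kd] := half_pow_small d0; apply: (nPq k); exact: dP.
Qed.

End Bisection.

(** * Goursat's lemma for Riemann sums *)

Section Goursat.
Variable R : realType.
Local Notation C := (Cx R).
Implicit Types (g r : C -> C) (a u v : C).

Definition edge_mean g m a u : C :=
  m%:R^-1 * \sum_(j < m) g (a + rc (j%:R / m%:R) * u).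

(** Riemann sum, with m nodes on each side, for the integral of g(z) dz along the
    boundary of the parallelogram with vertex a and edge vectors u and v. *)
Definition boundary_sum g m a u v : C :=
  u * edge_mean g m a u + v * edge_mean g m (a + u) v
  - u * edge_mean g m (a + v) u - v * edge_mean g m a v.

Lemma edge_mean_double g m a u : (0 < m)%N ->
  edge_mean g (m + m) a u =
  2^-1 * (edge_mean g m a (2^-1 * u) + edge_mean g m (a + 2^-1 * u) (2^-1 * u)).
Proof.
move=> m0; have mR : (m%:R : R) != 0 by rewrite pnatr_eq0 -lt0n.
have mC : (m%:R : C) != 0 by rewrite pnatr_eq0 -lt0n.
have mm : ((m + m)%:R : R) = m%:R * 2 by rewrite addnn -muln2 natrM.
have h2 : (2^-1 : C) = rc 2^-1 by rewrite rcV rc_nat.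
rewrite /edge_mean big_split_ord /= -!mulrDr mulrA; congr (_ * (_ + _)).
- by rewrite natrD -invfM mulr_natl.
- apply: eq_bigr => j _; rewrite h2 mulrA -rcM; congr (g (_ + rc _ * _)).
  by rewrite mm invfM mulrA.
- apply: eq_bigr => j _; rewrite h2 mulrA -rcM -addrA -mulrDl -rcD.
  congr (g (_ + rc _ * _)).
  by rewrite mm invfM mulrA natrD mulrDl mulfV // mulrDl mul1r.
Qed.

(** The sums on the two sides of an inner edge have the same nodes and cancel, so
    additivity is an identity, as it is for integrals. *)
Lemma boundary_sum_double g m a u v : (0 < m)%N ->
  let h x := 2^-1 * x in
  boundary_sum g (m + m) a u v =
  boundary_sum g m a (h u) (h v) + boundary_sum g m (a + h u) (h u) (h v)
  + boundary_sum g m (a + h v) (h u) (h v)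
  + boundary_sum g m (a + h u + h v) (h u) (h v).
Proof.
move=> m0 h; rewrite /boundary_sum !edge_mean_double // -/(h _) -/(h _).
have hh x : h x + h x = x by rewrite /h; field.
have -> : a + h u + h v + h u = a + u + h v.
  by rewrite -[in RHS](hh u); ring.
have -> : a + h u + h v + h v = a + v + h u.
  by rewrite -[in RHS](hh v); ring.
have -> : a + h v + h u = a + h u + h v by ring.
have -> : a + h u + h u = a + u by rewrite -addrA hh.
have -> : a + h v + h v = a + v by rewrite -addrA hh.
rewrite -[X in X * (2^-1 * _)](hh u) -{1}[in LHS](hh u).
by rewrite /h; field.
Qed.

Lemma edge_mean_le g m a u (B : R) : 0 <= B ->
  (forall s, 0 <= s <= 1 -> rnorm (g (a + rc s * u)) <= B) ->
  rnorm (edge_mean g m a u) <= B.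
Proof.
move=> B0 gB; rewrite /edge_mean; case: m => [|m].
  by rewrite big_ord0 mulr0 rnorm0.
rewrite rnormM rnormV -rc_nat rnorm_rc ger0_norm // ler_pdivrMl //.
apply: le_trans (rnorm_sum _ _ _) _.
apply: (@le_trans _ _ (\sum_(j < m.+1) B)).
  apply: ler_sum => j _; apply: gB.
  by rewrite divr_ge0 //= ler_pdivrMr // mul1r ler_nat ltnW.
by rewrite sumr_const card_ord mulr_natl.
Qed.

Lemma boundary_sum_le g m a u v (B : R) : 0 <= B ->
  (forall s t, 0 <= s <= 1 -> 0 <= t <= 1 ->
     rnorm (g (a + rc s * u + rc t * v)) <= B) ->
  rnorm (boundary_sum g m a u v) <= 2 * (rnorm u + rnorm v) * B.
Proof.
move=> B0 gB.
have I0 : 0 <= (0 : R) <= 1 by rewrite lexx ler01.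
have I1 : 0 <= (1 : R) <= 1 by rewrite lexx ler01.
have e1 : rnorm (edge_mean g m a u) <= B.
  apply: edge_mean_le => // s hs; have := gB _ _ hs I0.
  by rewrite rc0 mul0r addr0.
have e2 : rnorm (edge_mean g m (a + u) v) <= B.
  by apply: edge_mean_le => // s hs; have := gB _ _ I1 hs; rewrite rc1 mul1r.
have e3 : rnorm (edge_mean g m (a + v) u) <= B.
  apply: edge_mean_le => // s hs; have := gB _ _ hs I1.
  by rewrite rc1 mul1r addrAC.
have e4 : rnorm (edge_mean g m a v) <= B.
  apply: edge_mean_le => // s hs; have := gB _ _ I0 hs.
  by rewrite rc0 mul0r addr0.
rewrite /boundary_sum; apply: le_trans (rnormB _ _) _.
apply: le_trans (lerD (rnormB _ _) (lexx _)) _.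
apply: le_trans (lerD (lerD (rnormD _ _) (lexx _)) (lexx _)) _.
rewrite !(rnormM u) !(rnormM v).
have [u0 v0] := (rnorm_ge0 u, rnorm_ge0 v).
have h1 := ler_wpM2l u0 e1; have h2 := ler_wpM2l v0 e2.
have h3 := ler_wpM2l u0 e3; have h4 := ler_wpM2l v0 e4.
by lra.
Qed.

Lemma edge_mean_affine r m a u (c al z : C) : (0 < m)%N ->
  edge_mean (fun w => c + al * (w - z) + r w) m a u =
  c + al * (a - z) + al * u * (m%:R^-1 * \sum_(j < m) rc (j%:R / m%:R))
  + edge_mean r m a u.
Proof.
move=> m0; have mC : (m%:R : C) != 0 by rewrite pnatr_eq0 -lt0n.
rewrite /edge_mean big_split /= mulrDr; congr (_ + _).
rewrite mulrCA [in RHS]mulr_sumr.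
have {1}-> : c + al * (a - z) = m%:R^-1 * \sum_(j < m) (c + al * (a - z)).
  by rewrite sumr_const card_ord -[X in _ = _ * X]mulr_natl mulKf.
rewrite -mulrDr -big_split /=; congr (_ * _); apply: eq_bigr => j _.
by ring.
Qed.

(** Opposite edges carry nodes that differ by a translation, so the affine part
    contributes al (v u - u v) = 0. *)
Lemma boundary_sum_affine r m a u v (c al z : C) : (0 < m)%N ->
  boundary_sum (fun w => c + al * (w - z) + r w) m a u v = boundary_sum r m a u v.
Proof.
by move=> m0; rewrite /boundary_sum !edge_mean_affine //; ring.
Qed.

Lemma dist_in_box (s0 t0 d s t l m : R) u v :
  0 <= d -> s0 <= s <= s0 + d -> t0 <= t <= t0 + d ->
  0 <= l <= 1 -> 0 <= m <= 1 ->
  rnorm (rc s0 * u + rc t0 * v + rc l * (rc d * u) + rc m * (rc d * v)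
         - (rc s * u + rc t * v)) <= d * (rnorm u + rnorm v).
Proof.
move=> d0 /andP[s1 s2] /andP[t1 t2] /andP[l0 l1] /andP[m0 m1].
have -> : rc s0 * u + rc t0 * v + rc l * (rc d * u) + rc m * (rc d * v)
   - (rc s * u + rc t * v) = rc (s0 + l * d - s) * u + rc (t0 + m * d - t) * v.
  by rewrite !rcB !rcD !rcM; ring.
apply: le_trans (rnormD _ _) _; rewrite !rnormM !rnorm_rc mulrDr.
have [ld0 ld] : 0 <= l * d /\ l * d <= d by rewrite mulr_ge0 // ler_piMl.
have [md0 md] : 0 <= m * d /\ m * d <= d by rewrite mulr_ge0 // ler_piMl.
by rewrite lerD // ler_wpM2r ?rnorm_ge0 // ler_norml; apply/andP; split; lra.
Qed.

(** Near a point where it is differentiable, g is affine up to a small multiple of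
    the distance, and this remainder contributes a small multiple of the area of
    the parallelogram; [cousin_square] assembles these local bounds.  The number
    of nodes is a power of 2 because passing to a quarter halves it. *)
Lemma goursat g a u v :
  (forall s t, 0 <= s <= 1 -> 0 <= t <= 1 ->
     exists al, has_diff g (a + rc s * u + rc t * v) ( *%R al)) ->
  forall e : R, 0 < e -> exists N, forall n, (N <= n)%N ->
    rnorm (boundary_sum g (2 ^ n) a u v) <= e.
Proof.
move=> gdiff e e0.
pose M := rnorm u + rnorm v.
have M0 : 0 <= M by rewrite addr_ge0 // rnorm_ge0.
pose P k s t := exists N, forall n, (N <= n)%N ->
  rnorm (boundary_sum g (2 ^ n) (a + rc s * u + rc t * v)
    (rc (2^-1 ^+ k) * u) (rc (2^-1 ^+ k) * v)) <= e * (2^-1 ^+ k) ^+ 2.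
suff: P 0%N 0 0.
  by rewrite /P !rc0 !mul0r !addr0 !expr0 rc1 !mul1r expr1n mulr1.
apply: cousin_square => [k s t d [N1 h1] [N2 h2] [N3 h3] [N4 h4]|s t hs ht].
  exists (maxn (maxn N1 N2) (maxn N3 N4)).+1; case => // n.
  rewrite ltnS !geq_max => /andP[/andP[n1 n2] /andP[n3 n4]].
  rewrite expnS mul2n -addnn boundary_sum_double ?expn_gt0 //.
  have hd x : 2^-1 * (rc (2^-1 ^+ k) * x) = rc d * x.
    by rewrite mulrA /d exprS rcM rcV rc_nat.
  rewrite !hd.
  have -> : e * (2^-1 ^+ k) ^+ 2 = e * d ^+ 2 + e * d ^+ 2 + e * d ^+ 2 + e * d ^+ 2.
    by rewrite half_powS -/d; ring.
  have -> : a + rc s * u + rc t * v + rc d * u = a + rc (s + d) * u + rc t * v.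
    by rewrite rcD; ring.
  have -> : a + rc s * u + rc t * v + rc d * v = a + rc s * u + rc (t + d) * v.
    by rewrite rcD; ring.
  have -> : a + rc (s + d) * u + rc t * v + rc d * v =
            a + rc (s + d) * u + rc (t + d) * v by rewrite (rcD t); ring.
  apply: le_trans (rnormD _ _) (lerD _ (h4 _ n4)).
  apply: le_trans (rnormD _ _) (lerD _ (h3 _ n3)).
  exact: le_trans (rnormD _ _) (lerD (h1 _ n1) (h2 _ n2)).
have [al gal] := gdiff s t hs ht.
set z := a + rc s * u + rc t * v in gal.
(* The remainder is at most eta del M on a parallelogram of
   perimeter 2 del M. *)
pose eta := e / (2 * M ^+ 2 + 1).
have D0 : 0 < 2 * M ^+ 2 + 1 by rewrite ltr_wpDl // mulr_ge0 // sqr_ge0.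
have eta0 : 0 < eta by rewrite divr_gt0.
have [d d0 dP] := gal _ eta0.
exists (d / (M + 1)); first by rewrite divr_gt0 // ltr_wpDl.
move=> k s' t' kd hs' ht'; exists 0%N => n _.
set del : R := 2^-1 ^+ k in kd hs' ht' *.
have del0 : 0 < del by exact: half_pow_gt0.
have delM : del * M < d.
  move: kd; rewrite ltr_pdivlMr ?ltr_wpDl // mulrDr mulr1; lra.
pose r w := g w - (g z + al * (w - z)).
have gE : g = (fun w => g z + al * (w - z) + r w).
  by apply/funext => w; rewrite /r addrC subrK.
rewrite gE boundary_sum_affine ?expn_gt0 //.
apply: (@le_trans _ _ (2 * (rnorm (rc del * u) + rnorm (rc del * v)) * (eta * (del * M)))).
  apply: boundary_sum_le; first by rewrite mulr_ge0 ?(ltW eta0) // mulr_ge0 // ltW.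
  move=> l m hl hm; set w := _ + rc m * _.
  have wz : rnorm (w - z) <= del * M.
    have := dist_in_box u v (ltW del0) hs' ht' hl hm.
    by congr (rnorm _ <= _); rewrite /w /z; ring.
  have -> : r w = g (z + (w - z)) - g z - al * (w - z).
    by rewrite /r [z + _]addrC subrK opprD addrA.
  apply: le_trans (dP _ (le_lt_trans wz delM)) _.
  by rewrite ler_wpM2l // ltW.
rewrite !rnormM rnorm_rc ger0_norm ?(ltW del0) //.
have -> : 2 * (del * rnorm u + del * rnorm v) * (eta * (del * M)) =
    (2 * M ^+ 2 * eta) * del ^+ 2 by rewrite /M; ring.
rewrite ler_wpM2r ?sqr_ge0 // /eta mulrCA ler_piMr ?(ltW e0) //.
by rewrite ler_pdivrMr // mul1r lerDl.
Qed.

End Goursat.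

(** * The complex exponential *)

Section ComplexExponential.
Variable R : realType.
Local Notation C := (Cx R).

Definition cexp (z : C) : C :=
  rc (expR (complex.Re z)) * (cos (complex.Im z) +i* sin (complex.Im z))%C.

Lemma cexpD (z w : C) : cexp (z + w) = cexp z * cexp w.
Proof.
case: z w => [a b] [c d]; rewrite /cexp /= expRD rcM.
rewrite [in RHS]mulrACA; congr (_ * _); rewrite cosD sinD.
by apply/eqP; rewrite eq_complex /=; apply/andP; split; apply/eqP; ring.
Qed.

Lemma cexp0 : cexp 0 = 1.
Proof. by rewrite /cexp /= expR0 cos0 sin0 rc1 mul1r. Qed.

Lemma cexpN (z : C) : cexp (- z) = (cexp z)^-1.
Proof.
have h : cexp z * cexp (- z) = 1 by rewrite -cexpD subrr cexp0.
have nz : cexp z != 0 by apply: contra_eq_neq h => ->; rewrite mul0r eq_sym oner_eq0.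
by apply: (mulfI nz); rewrite h divff.
Qed.

Lemma cexp_period (z : C) : cexp (z + (0 +i* (pi *+ 2))%C) = cexp z.
Proof. by rewrite cexpD {2}/cexp /= expR0 cos2pi sin2pi rc1 !mulr1. Qed.

Lemma rnorm_cis (y : R) : rnorm ((cos y +i* sin y)%C : C) = 1.
Proof.
apply: complexI; rewrite -/(rc _) -rnormE normc_def /= cos2Dsin2 sqrtr1.
by [].
Qed.

Lemma rnorm_cexp (z : C) : rnorm (cexp z) = expR (complex.Re z).
Proof. by rewrite rnormM rnorm_rc rnorm_cis mulr1 ger0_norm // expR_ge0. Qed.

Lemma cexp_neq0 (z : C) : cexp z != 0.
Proof. by rewrite -rnorm_gt0 rnorm_cexp expR_gt0. Qed.

Lemma is_derive_taylor1 (f : R -> R) (a : R) : is_derive (0 : R) (1 : R) f a ->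
  forall e : R, 0 < e -> exists2 d : R, 0 < d &
    forall x, `|x| < d -> `|f x - f 0 - a * x| <= e * `|x|.
Proof.
move=> fa e e0; have df : differentiable f 0 by apply/derivable1_diffP.
have /eqaddoP/(_ e e0)/nbhs_norm0P[d /= d0 dP] := diff_locally df.
exists d => // x /dP; rewrite !fctE /= addr0 opprD addrA.
rewrite (_ : 'd f 0 x = a * x) //.
by rewrite diff1E // derive1E derive_val -[_ *: _]/(_ * _) mulrC.
Qed.

Lemma cexp_taylor1 (e : R) : 0 < e -> exists2 d : R, 0 < d &
  forall h : C, rnorm h < d -> rnorm (cexp h - 1 - h) <= e * rnorm h.
Proof.
move=> e0; pose n := e / 4; have n0 : 0 < n by rewrite divr_gt0.
have [d1 d10 h1] := is_derive_taylor1 (is_derive_expR 0) n0.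
have [d2 d20 h2] := is_derive_taylor1 (is_derive_cos 0) n0.
have [d3 d30 h3] := is_derive_taylor1 (is_derive_sin 0) n0.
pose d4 := n / (2 * n + 1).
have D0 : 0 < 2 * n + 1 by lra.
have d40 : 0 < d4 by rewrite divr_gt0.
exists (Num.min (Num.min d1 d2) (Num.min d3 d4)); first by rewrite !lt_min d10 d20 d30.
move=> h; rewrite !lt_min => /andP[/andP[hd1 hd2] /andP[hd3 hd4]].
have := rnorm_ge_Re h; have := rnorm_ge_Im h.
set x := complex.Re h; set y := complex.Im h => yh xh.
have {}h1 := h1 x (le_lt_trans xh hd1).
have {}h2 := h2 y (le_lt_trans yh hd2).
have {}h3 := h3 y (le_lt_trans yh hd3).
rewrite expR0 mul1r in h1; rewrite cos0 sin0 oppr0 mul0r subr0 in h2.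
rewrite sin0 cos0 subr0 mul1r in h3.
pose cis : C := (cos y +i* sin y)%C.
have cis1 : rnorm (cis - 1 - (0 +i* y)%C) <= 2 * n * rnorm h.
  apply: le_trans (rnorm_le_ReIm _) _ => /=.
  rewrite !subr0; have := ler_wpM2l (ltW n0) yh; lra.
have cis2 : rnorm (cis - 1) <= (2 * n + 1) * rnorm h.
  rewrite -[cis - 1](subrK ((0 +i* y)%C : C)); apply: le_trans (rnormD _ _) _.
  rewrite mulrDl mul1r lerD //; apply: le_trans (rnorm_le_ReIm _) _ => /=.
  by rewrite normr0 add0r.
have -> : cexp h - 1 - h =
    rc (expR x - 1 - x) * cis + rc x * (cis - 1) + (cis - 1 - (0 +i* y)%C).
  transitivity (cexp h - 1 - (rc x + (0 +i* y)%C)).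
    congr (_ - _); rewrite /x /y; case: (h) => a b; apply/eqP.
    by rewrite eq_complex /= addr0 add0r !eqxx.
  by rewrite {1}/cexp -/x -/y -/cis !rcB; ring.
apply: le_trans (rnormD _ _) _; apply: le_trans (lerD (rnormD _ _) (lexx _)) _.
rewrite !rnormM !rnorm_rc rnorm_cis mulr1.
have t2 : `|x| * rnorm (cis - 1) <= n * rnorm h.
  apply: le_trans (ler_wpM2l (normr_ge0 _) cis2) _.
  rewrite mulrA ler_wpM2r ?rnorm_ge0 //.
  have := le_trans xh (ltW hd4); rewrite /d4 ler_pdivlMr //.
have t1 := ler_wpM2l (ltW n0) xh.
have n4 : e = 4 * n by rewrite /n; field.
rewrite n4; lra.
Qed.

Lemma cexp_differentiable (z : C) : differentiable cexp z.
Proof.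
apply: (proj1 (@has_diff_differentiable _ C C cexp z ( *:%R (cexp z))
  (rnorm (cexp z)) _ _)); first by move=> h; rewrite rnormZ.
move=> e e0; have nz : 0 < rnorm (cexp z) by rewrite rnorm_gt0 cexp_neq0.
have [d d0 dP] := cexp_taylor1 (divr_gt0 e0 nz).
exists d => // h /dP; rewrite cexpD.
have -> : cexp z * cexp h - cexp z - cexp z *: h = cexp z * (cexp h - 1 - h).
  by rewrite -[_ *: h]/(_ * h); ring.
move=> hh; rewrite rnormM; apply: le_trans (ler_wpM2l (ltW nz) hh) _.
by rewrite mulrA mulrCA divff ?gt_eqF // mulr1.
Qed.

End ComplexExponential.

(** * Cauchy's estimate and the mean value inequality *)

Section CauchyEstimate.
Variable R : realType.
Local Notation C := (Cx R).

Lemma diff_scalar (W : normedModType C) (f : C -> W) (z h : C) :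
  differentiable f z -> 'd f z h = h *: 'd f z 1.
Proof. by move=> df; rewrite -linearZ /= -[h *: 1]/(h * 1) mulr1. Qed.

Lemma has_diff_complex (f : C -> C) (z : C) :
  differentiable f z -> has_diff f z ( *%R ('d f z 1)).
Proof.
move=> df e /(differentiable_has_diff df)[d d0 dP]; exists d => // h /dP.
by rewrite (diff_scalar h df) -[h *: _]/(h * _) [h * _]mulrC.
Qed.

Lemma is_diff_line (V : normedModType C) (z h : V) (t : C) :
  is_diff t (fun s : C => z + s *: h) (fun s => s *: h).
Proof.
have h1 := is_diff_cst z t; have h2 := is_diff_scalel t h.
by have := is_diffD h1 h2; rewrite add0r.
Qed.

Lemma diff_line (V W : normedModType C) (G : V -> W) (z h : V) (t : C) :
  differentiable G (z + t *: h) ->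
  differentiable (fun s : C => G (z + s *: h)) t /\
  'd (fun s : C => G (z + s *: h)) t 1 = 'd G (z + t *: h) h.
Proof.
move=> dG; have dl := is_diff_line z h t.
have dl' : differentiable (fun s : C => z + s *: h) t by exact: ex_diff.
split; first exact: (differentiable_comp dl' dG).
by rewrite (diff_comp dl' dG) /= diff_val scale1r.
Qed.

(** For g s = (f w - f 0) / w with w = exp s, circles around 0 become vertical
    segments and the horizontal sides of a box of height 2 pi cancel by
    periodicity.  So Goursat's lemma compares the mean of (f w - f 0) / w over a
    small circle, which is close to f' 0, with its mean over the circle of radius
    rho / 2, which is at most 2 M / (rho / 2). *)
Lemma cauchy_estimate0 (f : C -> C) (rho M : R) : 0 < rho ->
  (forall w, rnorm w < rho -> differentiable f w) ->
  (forall w, rnorm w < rho -> rnorm (f w) <= M) ->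
  rnorm ('d f 0 1) <= 4 * M / rho.
Proof.
move=> rho0 fd fM.
have f0 : differentiable f 0 by apply: fd; rewrite rnorm0.
pose r := rho / 2; have r0 : 0 < r by rewrite divr_gt0.
have rrho : r < rho by rewrite /r; lra.
apply/ler_addgt0Pl => e e0; have e20 : 0 < e / 2 by rewrite divr_gt0.
have [d d0 dP] := has_diff_complex f0 e20.
pose del := Num.min (d / 2) (r / 2).
have del0 : 0 < del by rewrite lt_min !divr_gt0.
have deld : del < d by rewrite gt_min; apply/orP; left; lra.
have delr : del < r by rewrite gt_min; apply/orP; right; lra.
(* The box of all s with del <= |exp s| <= r, cut open along a ray. *)
pose a := rc (ln del); pose u := rc (ln r - ln del).
pose v : C := (0 +i* (pi *+ 2))%C.
pose g (s : C) := (f (cexp s) - f 0) * cexp (- s).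
have u0 : 0 < ln r - ln del by rewrite subr_gt0 ltr_ln.
have Rebox s t : complex.Re (a + rc s * u + rc t * v) = ln del + s * (ln r - ln del).
  by rewrite /= !mul0r !subr0 mulr0 addr0.
have cbox s t : 0 <= s <= 1 -> rnorm (cexp (a + rc s * u + rc t * v)) <= r.
  move=> /andP[s0 s1]; rewrite rnorm_cexp Rebox -[leRHS]lnK ?posrE // ler_expR.
  by have := ler_wpM2r (ltW u0) s1; rewrite mul1r; lra.
have gd (s : C) : rnorm (cexp s) < rho -> differentiable g s.
  move=> hs; have d1 : differentiable (f \o @cexp R) s.
    by apply: differentiable_comp; [exact: cexp_differentiable|exact: fd].
  have d2 : differentiable (@cexp R \o (- (id : C -> C))) s.
    have dN : differentiable (- (id : C -> C)) s by exact/differentiableN/ex_diff.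
    exact: (differentiable_comp dN (cexp_differentiable _)).
  have -> : g = (f \o @cexp R - cst (f 0)) * (@cexp R \o (- (id : C -> C))) by [].
  have d3 := differentiableB d1 (differentiable_cst (f 0) s).
  exact: (differentiableM d3 d2).
have v0 : 0 < rnorm v.
  rewrite rnorm_gt0 eq_complex /= eqxx /= mulrn_eq0 /=.
  by rewrite gt_eqF // pi_gt0.
have [||N hN] := @goursat _ g a u v _ (e / 2 * rnorm v).
- move=> s t hs ht; exists ('d g (a + rc s * u + rc t * v) 1).
  by apply/has_diff_complex/gd/(le_lt_trans (cbox s t hs)).
- by rewrite mulr_gt0.
have {}hN := hN N (leqnn N); set m := (2 ^ N)%N in hN.
have m0 : (0 < m)%N by rewrite expn_gt0.
have gper s : g (s + v) = g s.
  by rewrite /g cexp_period opprD -[cexp (- s - v)]cexp_period -/v subrK.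
have per : edge_mean g m (a + v) u = edge_mean g m a u.
  rewrite /edge_mean; congr (_ * _); apply: eq_bigr => j _.
  by rewrite addrAC gper.
have {}hN : rnorm (edge_mean g m (a + u) v - edge_mean g m a v) <= e / 2.
  have E : boundary_sum g m a u v =
      v * (edge_mean g m (a + u) v - edge_mean g m a v).
    by rewrite /boundary_sum per; ring.
  by move: hN; rewrite E rnormM mulrC ler_pM2r.
have inner : rnorm (edge_mean g m a v - 'd f 0 1) <= e / 2.
  have -> : edge_mean g m a v - 'd f 0 1 = edge_mean (fun w => g w - 'd f 0 1) m a v.
    have {1}-> : g = (fun w => 'd f 0 1 + 0 * (w - a) + (g w - 'd f 0 1)).
      by apply/funext => w; ring.
    by rewrite edge_mean_affine //; ring.
  apply: edge_mean_le => [|s hs]; first exact: ltW.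
  set w := a + rc s * v.
  have wdel : rnorm (cexp w) = del.
    by rewrite rnorm_cexp /w /= !mul0r !subr0 mulr0 addr0 lnK // posrE.
  have wE : g w - 'd f 0 1 = (f (0 + cexp w) - f 0 - 'd f 0 1 * cexp w) * cexp (- w).
    by rewrite /g add0r cexpN; field; exact: cexp_neq0.
  have := dP (cexp w); rewrite wdel => /(_ deld) h.
  rewrite wE rnormM cexpN rnormV wdel ler_pdivrMr //.
have outer : rnorm (edge_mean g m (a + u) v) <= 4 * M / rho.
  have M0 : 0 <= M by apply: le_trans (fM 0 _); rewrite ?rnorm_ge0 // rnorm0.
  apply: edge_mean_le => [|s hs]; first by rewrite divr_ge0 ?mulr_ge0 // ltW.
  have wr : rnorm (cexp (a + u + rc s * v)) = r.
    have := Rebox 1 s; rewrite rc1 mul1r rnorm_cexp => ->.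
    by rewrite mul1r addrC subrK lnK.
  rewrite /g rnormM cexpN rnormV wr.
  have -> : 4 * M / rho = (M + M) / r by rewrite /r; field; rewrite gt_eqF.
  rewrite ler_wpM2r ?invr_ge0 ?(ltW r0) //.
  by apply: le_trans (rnormB _ _) _; rewrite lerD // fM // ?wr ?rnorm0.
have -> : 'd f 0 1 = edge_mean g m (a + u) v -
   (edge_mean g m (a + u) v - edge_mean g m a v) - (edge_mean g m a v - 'd f 0 1).
  by ring.
apply: le_trans (rnormB _ _) _.
apply: le_trans (lerD (rnormB _ _) (lexx _)) _.
lra.
Qed.

Section Multivariate.
Variable V : normedModType C.
Implicit Types (G : V -> C) (z h : V).

(** Restriction to the complex line through z in the direction h. *)
Lemma cauchy_estimate G z (rho M : R) h : 0 < rho ->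
  (forall w, rnorm (w - z) < rho -> differentiable G w) ->
  (forall w, rnorm (w - z) < rho -> rnorm (G w) <= M) ->
  rnorm ('d G z h) <= 4 * M / rho * rnorm h.
Proof.
move=> rho0 Gd GM; have [->|h0] := eqVneq h 0.
  by rewrite linear0 !rnorm0 mulr0.
have hn : 0 < rnorm h by rewrite rnorm_gt0.
have inb (t : C) : rnorm t < rho / rnorm h -> rnorm (z + t *: h - z) < rho.
  by rewrite addrAC subrr add0r rnormZ ltr_pdivlMr.
have G0 : differentiable G (z + 0 *: h).
  by apply: Gd; rewrite scale0r addr0 subrr rnorm0.
have [_ d0] := diff_line G0; rewrite scale0r addr0 in d0; rewrite -d0.
apply: le_trans (cauchy_estimate0 (rho := rho / rnorm h) (M := M) _ _ _) _.
- exact: divr_gt0.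
- by move=> t /inb/Gd/diff_line[].
- by move=> t /inb/GM.
by rewrite invf_div mulrA mulrAC.
Qed.

(** Increments are additive along the segment, so [cousin_square], with the
    second coordinate idle, reduces the bound to the definition of the
    differential at one point. *)
Lemma mean_value_le G z h (B : R) :
  (forall s : R, 0 <= s <= 1 ->
     differentiable G (z + rc s *: h) /\ rnorm ('d G (z + rc s *: h) h) <= B) ->
  rnorm (G (z + h) - G z) <= B.
Proof.
move=> GB; apply/ler_addgt0Pl => e e0.
pose g (t : C) := G (z + t *: h).
pose P (k : nat) (s t : R) := rnorm (g (rc (s + 2^-1 ^+ k)) - g (rc s)) <= (e + B) * 2^-1 ^+ k.
suff: P 0%N 0 0.
  by rewrite /P expr0 add0r mulr1 /g rc0 rc1 scale1r scale0r addr0.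
apply: (@cousin_square R P) => [k s t d h1 h2 _ _|s t hs _].
  rewrite /P half_powS -/d mulrDr.
  have -> : g (rc (s + (d + d))) - g (rc s) =
     (g (rc (s + d)) - g (rc s)) + (g (rc (s + d + d)) - g (rc (s + d))).
    by rewrite addrA [RHS]addrC addrA subrK.
  by apply: le_trans (rnormD _ _) _; rewrite lerD.
have [Gd GBs] := GB s hs; have [gd gE] := diff_line Gd.
have [d d0 dP] := has_diff_complex gd e0.
have locl x : `|x - s| < d -> rnorm (g (rc x) - g (rc s)) <= (e + B) * `|x - s|.
  move=> xs; have {dP} := dP (rc (x - s)); rewrite rnorm_rc => /(_ xs).
  rewrite -/(g _) {1}/g -/(g _).
  have -> : rc s + rc (x - s) = rc x by rewrite -rcD addrC subrK.
  rewrite gE => hx.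
  apply: le_trans (rnorm_dist _ ('d G (z + rc s *: h) h * rc (x - s))) _.
  rewrite rnormM rnorm_rc mulrDl addrC lerD //.
  by rewrite ler_wpM2r.
exists d => // k s' t' kd /andP[s1 s2] _; rewrite /P.
have -> : g (rc (s' + 2^-1 ^+ k)) - g (rc s') =
   (g (rc (s' + 2^-1 ^+ k)) - g (rc s)) - (g (rc s') - g (rc s)) by ring.
apply: le_trans (rnormB _ _) _.
have n1 : `|s' + 2^-1 ^+ k - s| = s' + 2^-1 ^+ k - s by rewrite ger0_norm // subr_ge0.
have n2 : `|s' - s| = s - s' by rewrite ler0_norm ?opprB // subr_le0.
have := locl (s' + 2^-1 ^+ k); have := locl s'; rewrite n1 n2.
move=> /(_ ltac:(lra)) l1 /(_ ltac:(lra)) l2.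
apply: le_trans (lerD l2 l1) _.
by rewrite -mulrDr addrA subrK [s' + _]addrC addrK.
Qed.

End Multivariate.
End CauchyEstimate.

(** * Taylor remainders and uniform limits *)

Section LocalEstimates.
Variable R : realType.
Local Notation C := (Cx R).
Variable V : normedModType C.
Implicit Types (G : V -> C) (z h : V).

Lemma diffB_apply (f g : V -> C) z h : differentiable f z -> differentiable g z ->
  'd (f - g) z h = 'd f z h - 'd g z h.
Proof. by move=> df dg; exact: (congr1 (fun k : V -> C => k h) (diffB df dg)). Qed.

(** Cauchy's estimate on the balls of radius rho / 2 around the points of the
    segment from w to w'. *)
Lemma lipschitz_bound G z (rho M : R) w w' :
  (forall p, rnorm (p - z) < rho -> differentiable G p) ->
  (forall p, rnorm (p - z) < rho -> rnorm (G p) <= M) ->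
  rnorm (w - z) < rho / 2 -> rnorm (w' - z) < rho / 2 ->
  rnorm (G w' - G w) <= 8 * M / rho * rnorm (w' - w).
Proof.
move=> Gd GM wz w'z.
have rho20 : 0 < rho / 2 by apply: le_lt_trans wz; exact: rnorm_ge0.
have rho0 : 0 < rho by lra.
have -> : G w' = G (w + (w' - w)) by rewrite addrC subrK.
apply: mean_value_le => s /andP[s0 s1]; set p := w + _.
have pz : rnorm (p - z) < rho / 2.
  have -> : p - z = rc (1 - s) *: (w - z) + rc s *: (w' - z).
    have -> : p = w + rc s *: ((w' - z) - (w - z)) by rewrite opprB addrA subrK.
    by rewrite scalerBr rcB rc1 scalerBl scale1r addrAC addrA [RHS]addrAC.
  apply: le_lt_trans (rnormD _ _) _; rewrite !rnormZ !rnorm_rc.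
  rewrite [`|s|]ger0_norm // ger0_norm ?subr_ge0 //.
  have [->|sn] := eqVneq s 0; first by rewrite mul0r addr0 subr0 mul1r.
  have s0' : 0 < s by rewrite lt_def sn.
  have h1 : s * rnorm (w' - z) < s * (rho / 2) by rewrite ltr_pM2l.
  have h2 : (1 - s) * rnorm (w - z) <= (1 - s) * (rho / 2).
    by rewrite ler_wpM2l ?subr_ge0 // ltW.
  by lra.
have sub q : rnorm (q - p) < rho / 2 -> rnorm (q - z) < rho.
  by move=> qp; apply: le_lt_trans (rdist_triangle p q z) _; lra.
split; first by apply: Gd; lra.
have -> : 8 * M / rho = 4 * M / (rho / 2) by field; rewrite gt_eqF.
by apply: cauchy_estimate => // q /sub; [exact: Gd|exact: GM].
Qed.

(** The increment of G by h is holomorphic and of size O(|h|) by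
    [lipschitz_bound]; the same lemma applies to it again. *)
Lemma second_difference_bound G z (rho M : R) w w' h :
  (forall p, rnorm (p - z) < rho -> differentiable G p) ->
  (forall p, rnorm (p - z) < rho -> rnorm (G p) <= M) ->
  rnorm (w - z) < rho / 8 -> rnorm (w' - z) < rho / 8 -> rnorm h < rho / 4 ->
  rnorm ((G (w' + h) - G w') - (G (w + h) - G w)) <=
  256 * M / rho ^+ 2 * rnorm h * rnorm (w' - w).
Proof.
move=> Gd GM wz w'z hr.
have rho0 : 0 < rho by have := rnorm_ge0 h; lra.
pose K p := G (p + h) - G p.
have ball_shift p : rnorm (p - z) < rho / 4 -> rnorm (p + h - z) < rho / 2.
  move=> pz; rewrite addrAC; apply: le_lt_trans (rnormD _ _) _; lra.
have Kd p : rnorm (p - z) < rho / 4 -> differentiable K p.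
  move=> pz; have p2 := ball_shift p pz; apply: differentiableB.
    have ds : differentiable (id + cst h : V -> V) p.
      by apply: differentiableD; [exact: ex_diff|exact: differentiable_cst].
    apply: (@differentiable_comp _ _ _ _ (id + cst h) G) => //.
    by apply: Gd; rewrite fctE /=; lra.
  by apply: Gd; lra.
have KM p : rnorm (p - z) < rho / 4 -> rnorm (K p) <= 8 * M / rho * rnorm h.
  move=> pz; have p2 := ball_shift p pz; rewrite /K.
  have := lipschitz_bound (w := p) (w' := p + h) Gd GM.
  by rewrite [p + h]addrC addrK; apply; [lra|rewrite [h + p]addrC].
have -> : 256 * M / rho ^+ 2 * rnorm h = 8 * (8 * M / rho * rnorm h) / (rho / 4).
  by field; rewrite gt_eqF.
rewrite -/(K w') -/(K w); apply: (lipschitz_bound Kd KM); lra.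
Qed.

(** The continuity of the differential is not part of the definition of
    holomorphy.  It comes from [second_difference_bound], since differentials are
    limits of increments. *)
Lemma diff_lipschitz G z (rho M : R) w w' h :
  (forall p, rnorm (p - z) < rho -> differentiable G p) ->
  (forall p, rnorm (p - z) < rho -> rnorm (G p) <= M) ->
  rnorm (w - z) < rho / 8 -> rnorm (w' - z) < rho / 8 ->
  rnorm ('d G w' h - 'd G w h) <= 256 * M / rho ^+ 2 * rnorm (w' - w) * rnorm h.
Proof.
move=> Gd GM wz w'z.
have rho0 : 0 < rho by have := rnorm_ge0 (w - z); lra.
have [->|h0] := eqVneq h 0.
  by rewrite (linear0 ('d G w)) (linear0 ('d G w')) subrr !rnorm0 mulr0.
have hn : 0 < rnorm h by rewrite rnorm_gt0.
have Gw : differentiable G w by apply: Gd; lra.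
have Gw' : differentiable G w' by apply: Gd; lra.
apply/ler_addgt0Pl => e e0.
have n0 : 0 < e / 2 / rnorm h by rewrite !divr_gt0.
have [d1 d10 h1] := differentiable_has_diff Gw n0.
have [d2 d20 h2] := differentiable_has_diff Gw' n0.
pose d := Num.min (Num.min d1 d2) (rho / 4).
have d0 : 0 < d by rewrite !lt_min d10 d20 divr_gt0.
pose t := d / (2 * rnorm h).
have t0 : 0 < t by rewrite divr_gt0 // mulr_gt0.
have tn : rnorm (rc t *: h) = t * rnorm h by rewrite rnormZ rnorm_rc gtr0_norm.
have : t * rnorm h < d.
  by rewrite /t invfM mulrA mulfVK ?gt_eqF //; lra.
rewrite !lt_min -tn => /andP[/andP[td1 td2] td4].
have {h1} := h1 _ td1; have {h2} := h2 _ td2.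
have := second_difference_bound Gd GM wz w'z td4.
set A := G (w' + _) - _; set B := G (w + _) - _ => hAB h2 h1.
rewrite -(ler_pM2l t0) -[t in leLHS]gtr0_norm // -rnorm_rc -rnormM mulrBr.
have -> : rc t * 'd G w' h = 'd G w' (rc t *: h) by rewrite linearZ.
have -> : rc t * 'd G w h = 'd G w (rc t *: h) by rewrite linearZ.
set a := 'd G w' _ in h2 *; set b := 'd G w _ in h1 *.
have -> : a - b = (A - B) - (A - a) + (B - b) by ring.
apply: le_trans (rnormD _ _) _; apply: le_trans (lerD (rnormB _ _) (lexx _)) _.
move: h1 h2 hAB; rewrite tn => h1 h2 hAB.
have E : e / 2 / rnorm h * (t * rnorm h) = t * (e / 2).
  by field; rewrite gt_eqF.
rewrite E in h1 h2; rewrite [t * (e + _)]mulrDr.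
have -> : t * (256 * M / rho ^+ 2 * rnorm (w' - w) * rnorm h) =
  256 * M / rho ^+ 2 * (t * rnorm h) * rnorm (w' - w) by ring.
by lra.
Qed.

(** The mean value inequality for G minus its differential at z.  The constant
    depends on M and rho only, which makes the bound stable under limits. *)
Lemma taylor1_bound G z (rho M : R) h : 0 < rho ->
  (forall p, rnorm (p - z) < rho -> differentiable G p) ->
  (forall p, rnorm (p - z) < rho -> rnorm (G p) <= M) ->
  rnorm h < rho / 8 ->
  rnorm (G (z + h) - G z - 'd G z h) <= 256 * M / rho ^+ 2 * rnorm h ^+ 2.
Proof.
move=> rho0 Gd GM hr.
have Gz : differentiable G z by apply: Gd; rewrite subrr rnorm0.
have M0 : 0 <= M by apply: le_trans (GM z _); rewrite ?rnorm_ge0 // subrr rnorm0.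
have dl p : is_diff p ('d G z) ('d G z).
  have c : continuous ('d G z) by exact: diff_continuous.
  by apply: DiffDef; [exact: linear_differentiable|exact: diff_lin].
have -> : G (z + h) - G z - 'd G z h = (G - ('d G z : V -> C)) (z + h) - (G - ('d G z : V -> C)) z.
  by rewrite !fctE linearD; ring.
apply: mean_value_le => s /andP[s0 s1]; set p := z + _.
have pz : rnorm (p - z) <= rnorm h.
  rewrite /p addrAC subrr add0r rnormZ rnorm_rc ger0_norm //.
  by rewrite ler_piMl ?rnorm_ge0.
have Gp : differentiable G p by apply: Gd; lra.
have lp : differentiable ('d G z : V -> C) p by exact: ex_diff.
split; first exact: (differentiableB Gp lp).
have lE : 'd ('d G z : V -> C) p h = 'd G z h.
  by rewrite (diff_val (is_diff_def := dl p)).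
have -> : 'd (G - ('d G z : V -> C)) p h = 'd G p h - 'd G z h.
  by rewrite -lE; exact: diffB_apply.
have zz : rnorm (z - z) < rho / 8 by rewrite subrr rnorm0; lra.
have pz8 : rnorm (p - z) < rho / 8 by lra.
apply: le_trans (diff_lipschitz h Gd GM zz pz8) _.
rewrite expr2 mulrA; apply: ler_wpM2r; first exact: rnorm_ge0.
apply: ler_wpM2l pz; apply: divr_ge0; last exact: sqr_ge0.
by rewrite mulr_ge0 ?ler0n.
Qed.

(** Cauchy's estimate makes the differentials of the approximations at z converge,
    and [taylor1_bound], with a constant common to all of them, passes to the
    limit. *)
Theorem uniform_limit_differentiable (f : V -> C) z (rho : R) : 0 < rho ->
  (forall e : R, 0 < e -> exists G : V -> C, forall p, rnorm (p - z) < rho ->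
     differentiable G p /\ rnorm (f p - G p) <= e) ->
  differentiable f z.
Proof.
move=> rho0 fG.
have [G0 hG0] := fG 1 ltr01.
have zz : rnorm (z - z) < rho by rewrite subrr rnorm0.
(* f is bounded near z because it is close to a function continuous at z. *)
have [r [M [r0 rrho fM]]] : exists r M : R, [/\ 0 < r, r <= rho &
    forall p, rnorm (p - z) < r -> rnorm (f p) <= M].
  have [dG0 _] := hG0 z zz.
  have /cvgrPdist_le/(_ 1 ltr01)/nbhs_rnormP[d d0 dP] := differentiable_continuous dG0.
  exists (Num.min d rho), (rnorm (G0 z) + 2); split.
  - by rewrite lt_min d0.
  - by rewrite ge_min lexx orbT.
  move=> p; rewrite lt_min => /andP[pd prho].
  have := dP _ pd; rewrite /= rnormE (rc_le _ 1) rdistC => h1.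
  have [_ h2] := hG0 p prho.
  have := rnorm_dist (f p) (G0 p); have := rnorm_dist (G0 p) (G0 z); lra.
pose eps (n : nat) : R := n.+1%:R^-1.
have eps0 n : 0 < eps n by rewrite invr_gt0.
have eps1 n : eps n <= 1 by rewrite invf_le1 // ler1n.
have epsE e : 0 < e -> exists N, forall n, (N <= n)%N -> eps n <= e.
  move=> e0; exists (Num.bound e^-1) => n Nn.
  rewrite invf_ple ?posrE //; apply: le_trans (ltW (archi_boundP _)) _.
    by rewrite invr_ge0 ltW.
  by rewrite ler_nat (leq_trans Nn).
have [G hG] := choice (fun n => fG (eps n) (eps0 n)).
have Gd n p : rnorm (p - z) < r -> differentiable (G n) p.
  by move=> pr; have [] := hG n p (lt_le_trans pr rrho).
have fGn n p : rnorm (p - z) < r -> rnorm (f p - G n p) <= eps n.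
  by move=> pr; have [] := hG n p (lt_le_trans pr rrho).
have GM n p : rnorm (p - z) < r -> rnorm (G n p) <= M + 1.
  move=> pr; have := fGn n p pr; have := fM p pr; have := eps1 n.
  have h := rnorm_dist (G n p) (f p); rewrite rdistC in h; lra.
have zr : rnorm (z - z) < r by rewrite subrr rnorm0.
have lim_d h : exists l, forall e : R, 0 < e ->
    exists N, forall n, (N <= n)%N -> rnorm ('d (G n) z h - l) <= e.
  apply: complex_cauchy_limit => e e0.
  have e'0 : 0 < e * r / (8 * (rnorm h + 1)).
    by rewrite divr_gt0 ?mulr_gt0 // ltr_wpDl ?rnorm_ge0.
  have [N hN] := epsE _ e'0; exists N => m n Nm Nn.
  have -> : 'd (G m) z h - 'd (G n) z h = 'd (G m - G n) z h.
    exact/esym/diffB_apply/(Gd n z zr)/(Gd m z zr).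
  have dGG p : rnorm (p - z) < r -> differentiable (G m - G n) p.
    by move=> pr; exact: (differentiableB (Gd m p pr) (Gd n p pr)).
  apply: le_trans (cauchy_estimate (M := 2 * (e * r / (8 * (rnorm h + 1)))) h r0 dGG _) _.
    move=> p pr; rewrite fctE.
    have -> : G m p - G n p = (f p - G n p) - (f p - G m p) by ring.
    apply: le_trans (rnormB _ _) _.
    by have := fGn m p pr; have := fGn n p pr; have := hN m Nm; have := hN n Nn; lra.
  have -> : 4 * (2 * (e * r / (8 * (rnorm h + 1)))) / r * rnorm h =
      e * (rnorm h / (rnorm h + 1)).
    by field; rewrite !gt_eqF // ltr_wpDl ?rnorm_ge0.
  rewrite ler_piMr ?(ltW e0) // ler_pdivrMr ?ltr_wpDl ?rnorm_ge0 //.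
  by rewrite mul1r lerDl.
have [L hL] := choice lim_d.
have L_lin : linear L.
  move=> a h k; apply/eqP; rewrite -subr_eq0; apply/eqP/rnorm_small => e e0.
  have e'0 : 0 < e / (rnorm a + 2) by rewrite divr_gt0 // ltr_wpDl ?rnorm_ge0.
  have [[N1 h1] [N2 h2]] := (hL (a *: h + k) _ e'0, hL h _ e'0).
  have [N3 h3] := hL k _ e'0.
  pose n := maxn (maxn N1 N2) N3.
  have {}h1 : rnorm _ <= _ := h1 n ltac:(by rewrite !leq_max leqnn).
  have {}h2 : rnorm _ <= _ := h2 n ltac:(by rewrite !leq_max leqnn orbT).
  have {}h3 : rnorm _ <= _ := h3 n ltac:(by rewrite !leq_max leqnn orbT).
  rewrite linearP in h1.
  have -> : L (a *: h + k) - (a *: L h + L k) =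
     a *: ('d (G n) z h - L h) + ('d (G n) z k - L k)
     - (a *: 'd (G n) z h + 'd (G n) z k - L (a *: h + k)).
    have sc (x y : C) : x *: y = x * y by [].
    by rewrite !sc; ring.
  apply: le_trans (rnormB _ _) _; apply: le_trans (lerD (rnormD _ _) (lexx _)) _.
  rewrite rnormZ; have h4 := ler_wpM2l (rnorm_ge0 a) h2.
  apply: le_trans (lerD (lerD h4 h3) h1) _.
  rewrite -[leRHS](@mulfVK _ (rnorm a + 2)) ?gt_eqF ?ltr_wpDl ?rnorm_ge0 //.
  by lra.
pose Lm := GRing.isLinear.Build _ _ _ _ _ L_lin.
pose Ll : {linear V -> C} := HB.pack L Lm.
have [] // := @has_diff_differentiable _ V C f z Ll (4 * (M + 1) / r).
  move=> h; apply/ler_addgt0Pl => e e0; have [N hN] := hL h e e0.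
  have {}hN := hN N (leqnn N); rewrite rdistC in hN.
  apply: le_trans (rnorm_dist _ ('d (G N) z h)) _; rewrite addrC lerD //.
  exact: (cauchy_estimate _ r0 (Gd N) (GM N)).
move=> e e0; pose K := 256 * (M + 1) / r ^+ 2.
have M0 : 0 <= M by apply: le_trans (fM z zr); rewrite rnorm_ge0.
have K0 : 0 <= K by rewrite divr_ge0 ?sqr_ge0 ?mulr_ge0 ?ler0n ?addr_ge0.
have K10 : 0 < K + 1 by rewrite ltr_wpDl.
exists (Num.min (r / 8) (e / (K + 1))); first by rewrite lt_min !divr_gt0.
move=> h; rewrite lt_min => /andP[hr he].
apply: (@le_trans _ _ (K * rnorm h ^+ 2)); last first.
  rewrite expr2 mulrA ler_wpM2r ?rnorm_ge0 //.
  move/ltW: he; rewrite ler_pdivlMr // => he; apply: le_trans he.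
  by rewrite mulrC ler_wpM2l ?rnorm_ge0 // lerDl.
apply/ler_addgt0Pl => d d0; have d30 : 0 < d / 3 by rewrite divr_gt0.
have [[N1 h1] [N2 h2]] := (hL h _ d30, epsE _ d30).
pose n := maxn N1 N2.
have {}h1 : rnorm _ <= _ := h1 n ltac:(by rewrite leq_max leqnn).
have {}h2 : eps n <= _ := h2 n ltac:(by rewrite leq_max leqnn orbT).
have zhr : rnorm (z + h - z) < r.
  by rewrite [z + h]addrC addrK; have := rnorm_ge0 h; lra.
have t := taylor1_bound r0 (Gd n) (GM n) hr.
have f1 := le_trans (fGn n _ zhr) h2; have f2 := le_trans (fGn n _ zr) h2.
have -> : f (z + h) - f z - Ll h =
  (G n (z + h) - G n z - 'd (G n) z h) + ('d (G n) z h - L h)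
   + (f (z + h) - G n (z + h)) - (f z - G n z) by rewrite /=; ring.
apply: le_trans (rnormB _ _) _; apply: le_trans (lerD (rnormD _ _) (lexx _)) _.
apply: le_trans (lerD (lerD (rnormD _ _) (lexx _)) (lexx _)) _.
rewrite -/K in t; lra.
Qed.

End LocalEstimates.

(** * Division of an increment by a coordinate *)

Section Division.
Variable R : realType.
Local Notation C := (Cx R).
Variables (V : normedModType C) (l : {linear V -> C}) (e : V).
Hypothesis l_le : forall z, rnorm (l z) <= rnorm z.
Hypothesis l_contract : forall (s : R) z, 0 <= s <= 1 ->
  rnorm (z - (rc s * l z) *: e) <= rnorm z.
Implicit Types (a : V -> C) (z w : V).

(** With l a coordinate and e the corresponding basis vector, z - l z *: e is the
    projection of z to the hyperplane l = 0.  On the hyperplane itself the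
    quotient is replaced by its limit, the derivative along e. *)
Definition divided a z : C :=
  if l z == 0 then 'd a z e else (a z - a (z - l z *: e)) / l z.

Lemma dividedE a z : a z = a (z - l z *: e) + l z * divided a z.
Proof.
rewrite /divided; case: eqVneq => [->|lz].
  by rewrite scale0r subr0 mul0r addr0.
by rewrite mulrC divfK // addrC subrK.
Qed.

Lemma affine_contract_differentiable (c : C) z :
  differentiable (fun w : V => w - (c * l w) *: e) z.
Proof.
have dl w : differentiable (l : V -> C) w.
  apply: (proj1 (@has_diff_differentiable R V C l w l 1 _ _)) => [h|d d0].
    by rewrite mul1r.
  exists 1 => // h _; rewrite linearD /=.
  by rewrite [l w + _]addrC addrK subrr rnorm0 mulr_ge0 ?rnorm_ge0 // ltW.
have d1 : differentiable (fun w => (l w : C) *: (c *: e)) z.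
  by apply: differentiableZl; exact: dl.
have -> : (fun w : V => w - (c * l w) *: e) = id - (fun w => (l w : C) *: (c *: e)).
  by apply/funext => w; rewrite !fctE scalerA [c * _]mulrC.
apply: differentiableB d1; exact: ex_diff.
Qed.

(** The derivative along h is the uniform limit of the difference quotients with a
    fixed step t. *)
Lemma directional_derivative_differentiable a (rho M : R) z h :
  (forall p, rnorm p < rho -> differentiable a p) ->
  (forall p, rnorm p < rho -> rnorm (a p) <= M) ->
  rnorm z < rho -> differentiable (fun p => 'd a p h : C) z.
Proof.
move=> ad aM zrho; pose r := (rho - rnorm z) / 2.
have r0 : 0 < r by rewrite divr_gt0 ?subr_gt0.
have M0 : 0 <= M by apply: le_trans (aM z zrho); exact: rnorm_ge0.
apply: (uniform_limit_differentiable r0) => d d0.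
have inball p q : rnorm (p - z) < r -> rnorm (q - p) < r -> rnorm q < rho.
  move=> pz qp; apply: le_lt_trans (rnorm_dist q p) _.
  have := rnorm_dist p z; rewrite /r in pz qp *; lra.
pose K := 256 * M / r ^+ 2 * (rnorm h + 1) ^+ 2.
have hn1 : 0 < rnorm h + 1 by rewrite ltr_wpDl ?rnorm_ge0.
have K0 : 0 <= K by rewrite mulr_ge0 ?divr_ge0 ?sqr_ge0 ?mulr_ge0 ?ler0n.
have K10 : 0 < K + 1 by rewrite ltr_wpDl.
pose t := Num.min (r / (16 * (rnorm h + 1))) (d / (K + 1)).
have h16 : 0 < 16 * (rnorm h + 1) by lra.
have t0 : 0 < t by rewrite lt_min; apply/andP; split; exact: divr_gt0.
have tC : rc t != 0 by rewrite rc_eq0 gt_eqF.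
have thn : rnorm (rc t *: h) = t * rnorm h by rewrite rnormZ rnorm_rc gtr0_norm.
have tr8 : rnorm (rc t *: h) < r / 8.
  have tle : t * (16 * (rnorm h + 1)) <= r.
    by rewrite -ler_pdivlMr // ge_min lexx.
  by rewrite thn; lra.
exists (fun p => (rc t)^-1 *: (a (p + rc t *: h) - a p)) => p pz.
have ap : differentiable a p by apply/ad/(inball p); rewrite ?subrr ?rnorm0.
split.
  have d1 : differentiable (fun q : V => a (q + rc t *: h)) p.
    have ds : differentiable (id + cst (rc t *: h) : V -> V) p.
      exact: (differentiableD (ex_diff (is_diff_def := is_diff_id p)) (differentiable_cst _ _)).
    apply: (differentiable_comp ds); apply: ad; apply: (inball p) => //.
    by rewrite fctE /= [p + _]addrC addrK; lra.
  exact: (differentiableZ (rc t)^-1 (differentiableB d1 ap)).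
have T := taylor1_bound r0 (fun q qp => ad q (inball p q pz qp))
  (fun q qp => aM q (inball p q pz qp)) tr8.
have sc (x y : C) : x *: y = x * y by [].
rewrite rdistC; set D := (X in rnorm X).
have -> : D = (rc t)^-1 * (a (p + rc t *: h) - a p - 'd a p (rc t *: h)).
  have lz : 'd a p (rc t *: h) = rc t * 'd a p h by rewrite linearZ.
  by rewrite lz /D !sc [RHS]mulrBr mulKf.
rewrite rnormM rnormV rnorm_rc gtr0_norm // ler_pdivrMl //; apply: le_trans T _.
rewrite thn; apply: (@le_trans _ _ (t * (t * K))).
  have -> : t * (t * K) = 256 * M / r ^+ 2 * (t * (rnorm h + 1)) ^+ 2.
    by rewrite /K; ring.
  apply: ler_wpM2l; first by rewrite divr_ge0 ?sqr_ge0 ?mulr_ge0 ?ler0n.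
  rewrite lerXn2r ?nnegrE ?mulr_ge0 ?rnorm_ge0 ?(ltW t0) ?(ltW hn1) //.
  by apply: ler_wpM2l; rewrite ?(ltW t0) // lerDl.
apply: ler_wpM2l; first exact: ltW.
have : t * (K + 1) <= d by rewrite -ler_pdivlMr // ge_min lexx orbT.
by move=> tK; have := ltW t0; lra.
Qed.

(** Cut the segment from the projection of p to p into n equal parts.  By
    [taylor1_bound] the increments of a over the parts differ from those of its
    linear approximations by O(|l p|^2 / n^2) each.  Summing and dividing by l p,
    the mean of the derivatives along e at the n points differs from the quotient
    by O(|l p| / n), uniformly up to the hyperplane l = 0. *)
Lemma divided_differentiable a (rho M : R) z :
  (forall p, rnorm p < rho -> differentiable a p) ->
  (forall p, rnorm p < rho -> rnorm (a p) <= M) ->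
  rnorm z < rho -> differentiable (divided a) z.
Proof.
move=> ad aM zrho; pose r := (rho - rnorm z) / 2.
have r0 : 0 < r by rewrite divr_gt0 ?subr_gt0.
have M0 : 0 <= M by apply: le_trans (aM z zrho); exact: rnorm_ge0.
have dd p : rnorm p < rho -> differentiable (fun p => 'd a p e : C) p.
  exact: (directional_derivative_differentiable _ ad aM).
apply: (uniform_limit_differentiable r0) => d d0.
pose K := 256 * M / r ^+ 2 * (rnorm e) ^+ 2 * rho.
have rho0 : 0 < rho by apply: le_lt_trans zrho; exact: rnorm_ge0.
have KK : 0 <= 256 * M / r ^+ 2.
  by rewrite divr_ge0 ?sqr_ge0 ?mulr_ge0 ?ler0n.
have K0 : 0 <= K.
  by apply: mulr_ge0 (ltW rho0); apply: mulr_ge0 KK _; exact: sqr_ge0.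
(* Both the total error and the length of a part must be small. *)
pose n := (Num.bound (K / d) + Num.bound (16 * rho * rnorm e / r)).+1.
have nK : K <= d * n%:R.
  rewrite mulrC -ler_pdivrMr //; apply: le_trans (ltW (archi_boundP _)) _.
    by rewrite divr_ge0 // ltW.
  by rewrite ler_nat leqW // leq_addr.
have nr : 16 * rho * rnorm e <= r * n%:R.
  rewrite [r * _]mulrC -ler_pdivrMr //; apply: le_trans (ltW (archi_boundP _)) _.
    apply: divr_ge0 (ltW r0); apply: mulr_ge0; last exact: rnorm_ge0.
    by apply: mulr_ge0 (ltW rho0); exact: ler0n.
  by rewrite ler_nat leqW // leq_addl.
have n0 : 0 < n%:R :> R by rewrite ltr0n.
have nC : (n%:R : C) != 0 by rewrite pnatr_eq0.
pose cf k : R := 1 - k%:R / n%:R.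
have cf01 k : (k <= n)%N -> 0 <= cf k <= 1.
  move=> kn; rewrite subr_ge0 ler_pdivrMr // mul1r ler_nat kn /=.
  by rewrite lerBlDr lerDl divr_ge0.
pose pt k p := p - (rc (cf k) * l p) *: e.
have pt_le k p : (k <= n)%N -> rnorm (pt k p) <= rnorm p.
  by move=> /cf01 h; exact: l_contract.
exists (fun p => n%:R^-1 *: \sum_(k < n) 'd a (pt k p) e) => p pz.
have prho : rnorm p < rho - r.
  by have := rnorm_dist p z; rewrite /r in pz *; lra.
split.
  apply: differentiableZ.
  have -> : (fun p => \sum_(k < n) 'd a (pt k p) e) =
            \sum_(k < n) (fun p => 'd a (pt k p) e : C).
    by apply/funext => q; rewrite fct_sumE.
  apply: differentiable_sum => k.
  apply: (@differentiable_comp _ _ _ _ (pt k) (fun q => 'd a q e : C)).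
    exact: affine_contract_differentiable.
  by apply: dd; apply: le_lt_trans (pt_le k p (ltnW (ltn_ord k))) _; lra.
rewrite /divided; have [lp|lp] := eqVneq (l p) 0.
  under eq_bigr => k _ do rewrite /pt lp mulr0 scale0r subr0.
  rewrite sumr_const card_ord -[_ *: _]/(_ * _) -[X in _ * X]mulr_natl mulKf //.
  by rewrite subrr rnorm0 ltW.
have sc (x y : C) : x *: y = x * y by [].
pose st : V := (l p / n%:R) *: e.
have ptS k : pt k.+1 p = pt k p + st.
  rewrite /pt /st -addrA; congr (_ + _); rewrite -!scaleNr -scalerDl; congr (_ *: _).
  rewrite /cf !rcB !rcM rcV !rc_nat -[k.+1%:R]natr1.
  by rewrite !sc; ring.
have pt0 : pt 0%N p = p - l p *: e by rewrite /pt /cf mul0r subr0 rc1 mul1r.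
have ptn : pt n p = p by rewrite /pt /cf divff ?gt_eqF // subrr rc0 mul0r scale0r subr0.
have stn : rnorm st = rnorm (l p) / n%:R * rnorm e.
  by rewrite rnormZ rnormM rnormV -rc_nat rnorm_rc gtr0_norm.
have lprho : rnorm (l p) <= rho by apply: le_trans (l_le p) _; lra.
have st8 : rnorm st < r / 8.
  have h1 : rnorm (l p) * rnorm e <= rho * rnorm e by rewrite ler_wpM2r ?rnorm_ge0.
  have rn : 0 < r * n%:R by exact: mulr_gt0.
  by rewrite stn mulrAC ltr_pdivrMr //; lra.
pose E := 256 * M / r ^+ 2 * rnorm st ^+ 2.
have step k : (k < n)%N -> rnorm (a (pt k.+1 p) - a (pt k p) - 'd a (pt k p) st) <= E.
  move=> kn; have ptk := pt_le k p (ltnW kn).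
  have inb q : rnorm (q - pt k p) < r -> rnorm q < rho.
    by move=> qp; have := rnorm_dist q (pt k p); lra.
  rewrite ptS; apply: taylor1_bound st8 => // q /inb; [exact: ad|exact: aM].
have tele : a p - a (p - l p *: e) = \sum_(k < n) (a (pt k.+1 p) - a (pt k p)).
  rewrite -(big_mkord xpredT (fun k => a (pt k.+1 p) - a (pt k p))).
  by rewrite telescope_sumr // ptn pt0.
have lpn : 0 < rnorm (l p) by rewrite rnorm_gt0.
have -> : (a p - a (p - l p *: e)) / l p - n%:R^-1 *: \sum_(k < n) 'd a (pt k p) e =
   (l p)^-1 * \sum_(k < n) (a (pt k.+1 p) - a (pt k p) - 'd a (pt k p) st).
  rewrite tele [in RHS]sumrB [RHS]mulrBr [X in X - _]mulrC; congr (_ - _).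
  rewrite sc !mulr_sumr; apply: eq_bigr => k _.
  have -> : 'd a (pt k p) st = l p / n%:R * 'd a (pt k p) e by rewrite linearZ.
  by rewrite !mulrA mulVf // mul1r.
rewrite rnormM rnormV ler_pdivrMl //; apply: le_trans (rnorm_sum _ _ _) _.
apply: (@le_trans _ _ (\sum_(k < n) E)).
  by apply: ler_sum => k _; exact: step.
rewrite sumr_const card_ord -[leLHS]mulr_natl /E stn.
have -> : n%:R * (256 * M / r ^+ 2 * (rnorm (l p) / n%:R * rnorm e) ^+ 2) =
  rnorm (l p) * (256 * M / r ^+ 2 * rnorm e ^+ 2 * rnorm (l p) / n%:R).
  by field; rewrite !gt_eqF.
apply: ler_wpM2l; first exact: ltW.
rewrite ler_pdivrMr //; apply: le_trans nK; apply: ler_wpM2l lprho.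
by apply: mulr_ge0 KK _; exact: sqr_ge0.
Qed.

End Division.

(** * Taylor expansions in one variable *)

Section OneVariable.
Variable R : realType.
Local Notation C := (Cx R).

Definition holo (V W : normedModType C) (f : V -> W) :=
  \forall z \near (0 : V), differentiable f z.

Lemma holo_ball (V W : normedModType C) (f : V -> W) : holo f ->
  exists rho M : R, [/\ 0 < rho,
    forall p, rnorm p < rho -> differentiable f p &
    forall p, rnorm p < rho -> rnorm (f p) <= M].
Proof.
move=> /nbhs0_rnormP[d1 d10 h1].
have f0 : differentiable f 0 by apply: h1; rewrite rnorm0.
have /cvgrPdist_le/(_ 1 ltr01)/nbhs0_rnormP[d2 d20 h2] := differentiable_continuous f0.
exists (Num.min d1 d2), (rnorm (f 0) + 1); split; first by rewrite lt_min d10.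
  by move=> p; rewrite lt_min => /andP[/h1].
move=> p; rewrite lt_min => /andP[_ /h2]; rewrite rnormE (rc_le _ 1) rdistC => h.
by apply: le_trans (rnorm_dist _ (f 0)) _; rewrite lerD2l.
Qed.

Definition dquot (a : C -> C) : C -> C := divided idfun 1 a.

Implicit Types (a : C -> C) (t z : C).

Lemma dquotE a t : a t = a 0 + t * dquot a t.
Proof. by rewrite {1}(dividedE idfun 1 a t) /= [t *: 1]mulr1 subrr. Qed.

Lemma idfun_contract (s : R) (z : C) : 0 <= s <= 1 ->
  rnorm (z - (rc s * z) *: (1 : C)) <= rnorm z.
Proof.
move=> /andP[s0 s1]; rewrite [_ *: 1]mulr1 -{1}[z]mul1r -mulrBl -rc1 -rcB.
rewrite rnormM rnorm_rc ger0_norm ?subr_ge0 // ler_piMl ?rnorm_ge0 //.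
by rewrite lerBlDr lerDl.
Qed.

Lemma dquot_differentiable a (rho M : R) z :
  (forall p, rnorm p < rho -> differentiable a p) ->
  (forall p, rnorm p < rho -> rnorm (a p) <= M) ->
  rnorm z < rho -> differentiable (dquot a) z.
Proof.
move=> ad aM zr.
have h1 (w : C) : rnorm ((idfun : {linear C -> C}) w) <= rnorm w by exact: lexx.
exact: (@divided_differentiable R C idfun 1 h1 idfun_contract a rho M z ad aM zr).
Qed.

Lemma dquot_holo a : holo a -> holo (dquot a).
Proof.
move=> /holo_ball[rho [M [rho0 ad aM]]]; apply/nbhs0_rnormP; exists rho => // z.
exact: dquot_differentiable aM.
Qed.

Lemma iter_dquot_holo k a : holo a -> holo (iter k dquot a).
Proof. by move=> ha; elim: k => //= k; exact: dquot_holo. Qed.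

(** For |z| >= rho / 2 the division costs a factor 4 / rho; for smaller |z|
    Lipschitz continuity is used.  The radius does not shrink, so the bound can be iterated. *)
Lemma dquot_bound a (rho M : R) z :
  (forall p, rnorm p < rho -> differentiable a p) ->
  (forall p, rnorm p < rho -> rnorm (a p) <= M) ->
  rnorm z < rho -> rnorm (dquot a z) <= 8 / rho * M.
Proof.
move=> ad aM zrho.
have rho0 : 0 < rho by apply: le_lt_trans zrho; exact: rnorm_ge0.
have M0 : 0 <= M by apply: le_trans (aM z zrho); exact: rnorm_ge0.
have ad' p : rnorm (p - 0) < rho -> differentiable a p by rewrite subr0; exact: ad.
have aM' p : rnorm (p - 0) < rho -> rnorm (a p) <= M by rewrite subr0; exact: aM.
have le48 : 4 * M / rho <= 8 / rho * M.
  rewrite [8 / rho * M]mulrAC; apply: ler_wpM2r; first by rewrite invr_ge0 ltW.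
  by lra.
rewrite /dquot /divided /=; have [->|z0] := eqVneq z 0.
  have := cauchy_estimate (1 : C) rho0 ad' aM'; rewrite rnorm1 mulr1 => h.
  exact: le_trans le48.
have zn : 0 < rnorm z by rewrite rnorm_gt0.
rewrite [z *: 1]mulr1 subrr rnormM rnormV ler_pdivrMr //.
have [zr|zr] := ltP (rnorm z) (rho / 2).
  have := lipschitz_bound ad' aM' (w := 0) (w' := z); rewrite !subr0 rnorm0.
  by move=> /(_ ltac:(lra) zr); rewrite [8 * M / rho]mulrAC.
apply: le_trans (rnormB _ _) _.
have a0 : rnorm (a 0) <= M by apply: aM; rewrite rnorm0.
have az := aM z zrho.
apply: le_trans (lerD az a0) _.
have -> : M + M = 4 / rho * M * (rho / 2) by field; rewrite gt_eqF.
apply: ler_pM => //; first by rewrite mulr_ge0 ?divr_ge0 ?ler0n ?(ltW rho0).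
  by rewrite divr_ge0 ?(ltW rho0).
apply: ler_wpM2r => //; apply: ler_wpM2r; first by rewrite invr_ge0 ltW.
by rewrite ler_nat.
Qed.

(** The values at 0 of the iterated divided differences are the Taylor
    coefficients, with an exact remainder. *)
Lemma taylor_dquot k a t :
  a t = \sum_(j < k) iter j dquot a 0 * t ^+ j + t ^+ k * iter k dquot a t.
Proof.
elim: k => [|k IH]; first by rewrite big_ord0 add0r mul1r.
rewrite {1}IH big_ord_recr /= [in LHS](dquotE (iter k dquot a) t) exprSr; ring.
Qed.

(** The remainder of order k in [taylor_dquot] is at most M (8 |t| / rho)^k. *)
Lemma holo_identity a : holo a -> (forall j, iter j dquot a 0 = 0) ->
  \forall t \near (0 : C), a t = 0.
Proof.
move=> /holo_ball[rho [M [rho0 ad aM]]] a0.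
have bnd k : (forall p, rnorm p < rho -> differentiable (iter k dquot a) p) /\
    (forall p, rnorm p < rho -> rnorm (iter k dquot a p) <= (8 / rho) ^+ k * M).
  elim: k => [|k [kd kM]] /=; first by split=> // p pr; rewrite mul1r aM.
  split=> p pr; first exact: dquot_differentiable kM pr.
  by rewrite exprS -mulrA; exact: dquot_bound kM pr.
have M0 : 0 <= M by apply: le_trans (aM 0 _); rewrite ?rnorm_ge0 // rnorm0.
apply/nbhs0_rnormP; exists (rho / 16); first by rewrite divr_gt0 ?ltr0n.
move=> t tr; apply: rnorm_small => e e0.
have tk k : rnorm (a t) <= 2^-1 ^+ k * M.
  rewrite (taylor_dquot k) big1 => [|j _]; last by rewrite a0 mul0r.
  rewrite add0r rnormM rnormX; have [_ kM] := bnd k.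
  have trho : rnorm t < rho by lra.
  apply: le_trans (ler_wpM2l _ (kM t trho)) _; first by rewrite exprn_ge0 ?rnorm_ge0.
  rewrite mulrA -exprMn; apply: ler_wpM2r => //.
  have r8 : 0 <= 8 / rho by rewrite divr_ge0 ?ler0n ?(ltW rho0).
  apply: lerXn2r; rewrite ?nnegrE ?invr_ge0 ?ler0n //.
    by rewrite mulr_ge0 ?rnorm_ge0.
  rewrite mulrA ler_pdivrMr //; lra.
have M10 : 0 < M + 1 by rewrite ltr_wpDl.
have [k hk] := half_pow_small (divr_gt0 e0 M10).
apply: le_trans (tk k) _; apply: le_trans (ler_wpM2r M0 (ltW hk)) _.
by rewrite mulrAC ler_pdivrMr // ler_wpM2l ?(ltW e0) // lerDl.
Qed.

End OneVariable.

(** * Row vectors *)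

Section RowVectors.
Variable R : realType.
Local Notation C := (Cx R).

Lemma rnorm_coord N (z : 'rV[C]_N) i : rnorm (z 0 i) <= rnorm z.
Proof.
rewrite -rc_le -!rnormE [X in _ <= X]/Num.norm /= mx_normE.
by rewrite -[leLHS]nngE num_le; exact: (le_bigmax _ _ (0, i)).
Qed.

Lemma rnorm_row_le N (z : 'rV[C]_N) (B : R) : 0 <= B ->
  (forall i, rnorm (z 0 i) <= B) -> rnorm z <= B.
Proof.
move=> B0 zB; have [->|z0] := eqVneq z 0; first by rewrite rnorm0.
have /mx_norm_neq0[[i j] /= zE] : mx_norm z != 0.
  by apply: contra z0 => /eqP/mx_norm_eq0 ->.
by rewrite -rc_le -rnormE [`|z|]zE rnormE rc_le ord1.
Qed.

Lemma differentiable_row (V : normedModType C) N (f : V -> 'rV[C]_N) z :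
  (forall j, differentiable (fun w => f w 0 j : C) z) -> differentiable f z.
Proof.
move=> fd; have -> : f = \sum_(j < N) (fun w => (f w 0 j : C) *: (delta_mx 0 j : 'rV[C]_N)).
  apply/funext => w; rewrite fct_sumE {1}[f w]matrix_sum_delta big_ord1.
  by [].
by apply: differentiable_sum => j; apply: differentiableZl; exact: fd.
Qed.

Lemma differentiable_entry (V : normedModType C) N (f : V -> 'rV[C]_N) z j :
  differentiable f z -> differentiable (fun w => f w 0 j : C) z.
Proof.
by move=> fd; exact: (differentiable_comp fd (differentiable_coord (f z) 0 j)).
Qed.

Lemma diff_entry (V : normedModType C) N (f : V -> 'rV[C]_N) z j h :
  differentiable f z -> 'd (fun w => f w 0 j : C) z h = 'd f z h 0 j.
Proof.
move=> fd; have L_lin : linear (fun h => 'd f z h 0 j : C).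
  by move=> a x y; rewrite linearP !mxE.
pose L : {linear V -> C} := HB.pack (fun h => 'd f z h 0 j : C)
  (GRing.isLinear.Build _ _ _ _ _ L_lin).
have fe := differentiable_entry j fd.
have [k kP] : exists k : R, forall h, rnorm ('d f z h) <= k * rnorm h.
  have /linear_boundedP[k [kr hk]] : bounded_near ('d f z) (nbhs (0 : V)).
    by apply/linear_bounded_continuous; exact: diff_continuous.
  have kk : k < `|k| + 1 by apply: (le_lt_trans (real_ler_norm kr)); rewrite ltrDl.
  have [r r0 rE] : exists2 r : R, 0 < r & `|k| + 1 = rc r.
    by apply: rc_pos; apply: ltr_wpDl.
  by exists r => x; rewrite -rc_le rcM -!rnormE -rE; exact: hk.
have [_ dE] : differentiable (fun w => f w 0 j : C) z /\
    'd (fun w => f w 0 j : C) z = L :> (V -> C).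
  apply: (@has_diff_differentiable R V C _ z L k) => [x|e e0].
    exact: le_trans (rnorm_coord _ _) (kP x).
  have [d d0 dP] := differentiable_has_diff fd e0; exists d => // x /dP.
  apply: le_trans; apply: le_trans (rnorm_coord _ j); rewrite !mxE.
  exact: lexx.
by rewrite dE.
Qed.

End RowVectors.

(** * Hadamard's lemma *)

Section Hadamard.
Variables (R : realType) (N : nat).
Local Notation C := (Cx R).
Implicit Types (a : 'rV[C]_N -> C) (z : 'rV[C]_N) (i : 'I_N).

Lemma coord_is_linear i : linear (fun z => z 0 i : C).
Proof. by move=> c x y; rewrite !mxE. Qed.

Definition coord_lin i : {linear 'rV[C]_N -> C} :=
  HB.pack (fun z : 'rV[C]_N => z 0 i : C) (GRing.isLinear.Build _ _ _ _ _ (coord_is_linear i)).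

Lemma coord_contract i (s : R) z : 0 <= s <= 1 ->
  rnorm (z - (rc s * coord_lin i z) *: delta_mx 0 i) <= rnorm z.
Proof.
move=> /andP[s0 s1]; apply: rnorm_row_le => [|j]; first exact: rnorm_ge0.
apply: le_trans (rnorm_coord z j); rewrite !mxE /= eq_sym.
have [->|ij] := eqVneq i j; last by rewrite mulr0 subr0.
rewrite mulr1 -{1}[z 0 j]mul1r -mulrBl -rc1 -rcB.
rewrite rnormM rnorm_rc ger0_norm ?subr_ge0 // ler_piMl ?rnorm_ge0 //.
by rewrite lerBlDr lerDl.
Qed.

Lemma divided_coord_differentiable i a (rho M : R) z :
  (forall p, rnorm p < rho -> differentiable a p) ->
  (forall p, rnorm p < rho -> rnorm (a p) <= M) ->
  rnorm z < rho -> differentiable (divided (coord_lin i) (delta_mx 0 i) a) z.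
Proof.
move=> ad aM zr.
have h1 w : rnorm (coord_lin i w) <= rnorm w by exact: rnorm_coord.
exact: (divided_differentiable h1 (coord_contract i) ad aM zr).
Qed.

Definition clear_below (k : nat) z : 'rV[C]_N :=
  \row_j (if (j < k)%N then 0 else z 0 j).

Lemma clear_belowS i z :
  clear_below i.+1 z = clear_below i z - z 0 i *: delta_mx 0 i.
Proof.
apply/rowP => j; rewrite !mxE /= ltnS leq_eqVlt eq_sym.
have [->|ij] := eqVneq i j; first by rewrite /= eqxx ltnn mulr1 subrr.
rewrite mulr0 subr0; case: (ltngtP i j) ij => // ij; rewrite ?ij //.
by rewrite (val_inj ij) eqxx.
Qed.

Lemma clear_below0 z : clear_below 0 z = z.
Proof. by apply/rowP => j; rewrite !mxE. Qed.

Lemma rnorm_clear_below k z : rnorm (clear_below k z) <= rnorm z.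
Proof.
apply: rnorm_row_le => [|j]; first exact: rnorm_ge0.
by rewrite !mxE; case: ifP => _; rewrite ?rnorm0 ?rnorm_ge0 ?rnorm_coord.
Qed.

Lemma clear_below_differentiable k z : differentiable (clear_below k) z.
Proof.
apply: differentiable_row => j.
have -> : (fun w => clear_below k w 0 j : C) =
    if (j < k)%N then cst 0 else (fun w : 'rV[C]_N => w 0 j : C).
  by apply/funext => w; rewrite !mxE; case: ifP.
by case: ifP => _; [exact: differentiable_cst|exact: differentiable_coord].
Qed.

(** The first k coordinates are cleared one after the other, and the increment at
    each step is divided by the coordinate in question. *)
Lemma hadamard a (k : nat) : (k <= N)%N -> holo a ->
  exists c : 'I_N -> 'rV[C]_N -> C, (forall i, holo (c i)) /\
    forall z, a z = a (clear_below k z) + \sum_(i < N | (i < k)%N) z 0 i * c i z.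
Proof.
move=> kN /holo_ball[rho [M [rho0 ad aM]]].
exists (fun i z => divided (coord_lin i) (delta_mx 0 i) a (clear_below i z)); split.
  move=> i; apply/nbhs0_rnormP; exists rho => // z zr.
  apply: (@differentiable_comp _ _ _ _ (clear_below i)
    (divided (coord_lin i) (delta_mx 0 i) a)).
    exact: clear_below_differentiable.
  by apply: divided_coord_differentiable ad aM _; exact: le_lt_trans (rnorm_clear_below _ _) zr.
move=> z; elim: k kN => [|k IH] kN.
  by rewrite big_pred0 // addr0 clear_below0.
rewrite {1}IH 1?ltnW //.
pose i := Ordinal kN.
rewrite (dividedE (coord_lin i) (delta_mx 0 i) a (clear_below k z)).
have -> : coord_lin i (clear_below k z) = z 0 i by rewrite /= mxE ltnn.
rewrite -(clear_belowS i) -addrA; congr (_ + _).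
rewrite [in RHS](bigD1 i) //=; congr (_ + _); apply: eq_bigl => j.
by rewrite [in LHS]ltn_neqAle andbC -val_eqE ltnS.
Qed.

End Hadamard.

(** * The inverse function theorem *)

Section InverseFunction.
Variables (R : realType) (N : nat).
Local Notation C := (Cx R).
Local Notation V := 'rV[C]_N.

Lemma geometric_limit (u : nat -> V) (B : R) : 0 <= B ->
  (forall k, rnorm (u k.+1 - u k) <= B * 2^-1 ^+ k.+1) ->
  exists x : V, forall k, rnorm (u k - x) <= B * 2^-1 ^+ k.
Proof.
move=> B0 uB.
have dist k j : rnorm (u (j + k)%N - u k) <= B * 2^-1 ^+ k - B * 2^-1 ^+ (j + k).
  elim: j => [|j IH]; first by rewrite !subrr rnorm0.
  apply: le_trans (rdist_triangle (u (j + k)%N) _ _) _.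
  apply: le_trans (lerD (uB _) IH) _.
  by have := half_powS R (j + k); rewrite addSn; nra.
have dist' k j : rnorm (u (j + k)%N - u k) <= B * 2^-1 ^+ k.
  apply: le_trans (dist k j) _; rewrite lerBlDr lerDl.
  by rewrite mulr_ge0 // ltW // half_pow_gt0.
have lim i : exists x : C, forall k, rnorm (u k 0 i - x) <= B * 2^-1 ^+ k.
  have [|x hx] := @complex_cauchy_limit R (fun k => u k 0 i).
    move=> e e0; have B10 : 0 < 2 * (B + 1) by lra.
    have [k hk] := half_pow_small (divr_gt0 e0 B10).
    exists k => m n km kn; rewrite ltr_pdivlMr // in hk.
    have := dist' k (m - k)%N; have := dist' k (n - k)%N.
    rewrite !subnK // => h1 h2.
    apply: le_trans (rdist_triangle (u k 0 i) _ _) _; rewrite [X in _ + X]rdistC.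
    have c1 := rnorm_coord (u n - u k) i; have c2 := rnorm_coord (u m - u k) i.
    rewrite !mxE in c1 c2; have := half_pow_gt0 R k; nra.
  exists x => k; apply/ler_addgt0Pr => e /hx[n hn].
  have := hn (n + k)%N (leq_addr _ _).
  have := rnorm_coord (u (n + k)%N - u k) i; rewrite !mxE.
  have := dist' k n; rewrite [rnorm (u k 0 i - _)]rdistC => h1 h2 h3.
  apply: le_trans (rdist_triangle (u (n + k)%N 0 i) _ _) _.
  rewrite rdistC in h3; lra.
have [x hx] := choice lim.
exists (\row_i x i) => k; apply: rnorm_row_le => [|i].
  by rewrite mulr_ge0 // ltW // half_pow_gt0.
by rewrite !mxE.
Qed.

(** The differential vanishes at 0, hence is small nearby by [diff_lipschitz]. *)
Lemma contraction_near0 (r : V -> V) : holo r -> (forall h, 'd r 0 h = 0) ->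
  exists2 d : R, 0 < d & (forall p, rnorm p < d -> differentiable r p) /\
    forall p q, rnorm p < d -> rnorm q < d -> rnorm (r q - r p) <= 2^-1 * rnorm (q - p).
Proof.
move=> /holo_ball[rho [M [rho0 rd rM]]] dr0.
have M0 : 0 <= M by apply: le_trans (rM 0 _); rewrite ?rnorm_ge0 // rnorm0.
pose K := 256 * M / rho ^+ 2.
have K0 : 0 <= K by rewrite divr_ge0 ?sqr_ge0 ?mulr_ge0 ?ler0n.
have K10 : 0 < 2 * (K + 1) by lra.
exists (Num.min (rho / 8) (2 * (K + 1))^-1); first by rewrite lt_min divr_gt0 ?ltr0n // invr_gt0.
split=> [p|p q]; first by rewrite lt_min => /andP[pr _]; apply: rd; lra.
rewrite !lt_min => /andP[p1 p2] /andP[q1 q2].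
apply: rnorm_row_le => [|i]; first by rewrite mulr_ge0 ?rnorm_ge0 ?invr_ge0 ?ler0n.
rewrite !mxE.
have rid w : rnorm (w - 0) < rho -> differentiable (fun p => r p 0 i : C) w.
  by rewrite subr0 => /rd; exact: differentiable_entry.
have riM w : rnorm (w - 0) < rho -> rnorm (r w 0 i) <= M.
  by rewrite subr0 => /rM; apply: le_trans; exact: rnorm_coord.
have -> : q = p + (q - p) by rewrite addrC subrK.
rewrite [p + _ - p]addrAC subrr add0r.
apply: (@mean_value_le R V (fun p => r p 0 i)) => s /andP[s0 s1].
set w := p + _.
have wE : w = rc (1 - s) *: p + rc s *: q.
  by rewrite /w rcB rc1 scalerBl scale1r scalerBr addrA addrAC.
have wlt (B : R) : rnorm p < B -> rnorm q < B -> rnorm w < B.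
  move=> pB qB; rewrite wE; apply: le_lt_trans (rnormD _ _) _.
  rewrite !rnormZ !rnorm_rc [`|s|]ger0_norm // ger0_norm ?subr_ge0 //.
  have [->|sn] := eqVneq s 0; first by rewrite mul0r addr0 subr0 mul1r.
  have s0' : 0 < s by rewrite lt_def sn.
  have h1 : s * rnorm q < s * B by rewrite ltr_pM2l.
  have h2 : (1 - s) * rnorm p <= (1 - s) * B by rewrite ler_wpM2l ?subr_ge0 // ltW.
  by lra.
have w1 := wlt _ p1 q1; have w2 := wlt _ p2 q2.
have w0r : rnorm (w - 0) < rho by rewrite subr0; lra.
split; first exact: rid.
have z8 : rnorm ((0 : V) - 0) < rho / 8 by rewrite subrr rnorm0 divr_gt0 ?ltr0n.
have w8 : rnorm (w - 0) < rho / 8 by rewrite subr0.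
have rd0 : differentiable r 0 by apply: rd; rewrite rnorm0.
have e0 : 'd (fun p => r p 0 i : C) 0 (q - p) = 0.
  by rewrite (diff_entry i (q - p) rd0) dr0 mxE.
have d0_le : rnorm ('d (fun p => r p 0 i : C) 0 (q - p)) <= 0 by rewrite e0 rnorm0.
have L := diff_lipschitz (q - p) rid riM z8 w8.
apply: le_trans (rnorm_dist _ _) _; apply: le_trans (lerD d0_le L) _.
rewrite add0r subr0; apply: ler_wpM2r; first exact: rnorm_ge0.
rewrite -/K; move/ltW: w2; rewrite -[_^-1]mul1r ler_pdivlMr // => wK.
by have wn := rnorm_ge0 w; clear -K0 wn wK; lra.
Qed.

(** With r = id - phi, psi w is the fixed point of the contraction x |-> w + r x.
    The Picard iterates are holomorphic in w and converge uniformly, so psi is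
    holomorphic as a uniform limit. *)
Theorem inverse_function (phi : V -> V) : map_germ phi ->
  (forall h, 'd phi 0 h = h) -> exists psi, biholomorphic_germ phi psi.
Proof.
move=> [phi_holo phi0] dphi.
have phid0 : differentiable phi 0 by have := nbhs_singleton phi_holo.
pose r : V -> V := id - phi.
have r_holo : holo r.
  apply: filterS phi_holo => z dz.
  by apply: (differentiableB (ex_diff (is_diff_def := is_diff_id z)) dz).
have r0 : r 0 = 0 by rewrite /r !fctE phi0 subr0.
have dr0 h : 'd r 0 h = 0.
  have i0 := is_diff_id (0 : V).
  have iE : 'd (id : V -> V) 0 h = h by rewrite (diff_val (is_diff_def := i0)).
  have E : 'd r 0 h = 'd (id : V -> V) 0 h - 'd phi 0 h.
    exact: (congr1 (fun k : V -> V => k h) (diffB (ex_diff (is_diff_def := i0)) phid0)).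
  exact: (etrans E (etrans (congr2 (fun x y : V => x - y) iE (dphi h)) (subrr h))).
have [d d0 [rd rlip]] := contraction_near0 r_holo dr0.
have z0 : rnorm (0 : V) < d by rewrite rnorm0.
have rle p : rnorm p < d -> rnorm (r p) <= 2^-1 * rnorm p.
  by move=> pd; have := rlip _ _ z0 pd; rewrite r0 !subr0.
pose it (k : nat) (w : V) : V := iter k (fun x => w + r x) 0.
have itS k w : it k.+1 w = w + r (it k w) by [].
have it_le k w : rnorm w < d / 2 -> rnorm (it k w) <= 2 * rnorm w.
  move=> wd; elim: k => [|k IH] /=; first by rewrite rnorm0 mulr_ge0 ?rnorm_ge0 ?ler0n.
  apply: le_trans (rnormD _ _) _; have := rle (it k w) ltac:(lra).
  by rewrite -/(it k w); lra.
have it_step k w : rnorm w < d / 2 ->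
    rnorm (it k.+1 w - it k w) <= 2 * rnorm w * 2^-1 ^+ k.+1.
  move=> wd; elim: k => [|k IH].
    by rewrite /= r0 addr0 subr0 expr1 mulrAC divff ?mul1r // pnatr_eq0.
  have -> : it k.+2 w - it k.+1 w = r (it k.+1 w) - r (it k w).
    by rewrite (itS k.+1) [X in _ - X]itS opprD addrA [w + _ - w]addrAC subrr add0r.
  have h1 := it_le k w wd; have h2 := it_le k.+1 w wd.
  have h3 : rnorm (it k w) < d by clear -h1 wd; lra.
  have h4 : rnorm (it k.+1 w) < d by clear -h2 wd; lra.
  apply: le_trans (rlip _ _ h3 h4) _.
  rewrite [2^-1 ^+ k.+2]exprS mulrCA; apply: ler_wpM2l IH.
  by rewrite invr_ge0 ler0n.
have lim (w : V) : exists x : V, rnorm w < d / 2 ->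
    forall k, rnorm (it k w - x) <= 2 * rnorm w * 2^-1 ^+ k.
  have [wd|wd] := ltP (rnorm w) (d / 2); last by exists 0.
  have [|x xP] := @geometric_limit (it ^~ w) (2 * rnorm w) _ (fun k => it_step k w wd).
    by rewrite mulr_ge0 ?rnorm_ge0 ?ler0n.
  by exists x.
have [psi psiP] : exists psi : V -> V, forall w, rnorm w < d / 2 ->
  forall k, rnorm (it k w - psi w) <= 2 * rnorm w * 2^-1 ^+ k.
  by have [g gP] := choice lim; exists g.
have psi_le w : rnorm w < d / 2 -> rnorm (psi w) <= 2 * rnorm w.
  move=> wd; have := psiP w wd 0%N.
  by rewrite expr0 mulr1 sub0r rnormN.
have itd k w : rnorm w < d / 2 -> differentiable (it k) w.
  move=> wd; elim: k => [|k IH]; first exact: differentiable_cst.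
  have kd : rnorm (it k w) < d by have := it_le k w wd; lra.
  have d1 : differentiable (r \o it k) w := differentiable_comp IH (rd _ kd).
  exact: (differentiableD (ex_diff (is_diff_def := is_diff_id w)) d1).
have psid w : rnorm w < d / 2 -> differentiable psi w.
  move=> wd; apply: differentiable_row => j.
  have t0 : 0 < d / 2 - rnorm w by rewrite subr_gt0.
  apply: (uniform_limit_differentiable t0) => e e0.
  have [k hk] := half_pow_small (divr_gt0 e0 d0).
  exists (fun w => it k w 0 j) => p pw.
  have pd : rnorm p < d / 2 by have := rnorm_dist p w; lra.
  split; first exact: (differentiable_entry j (itd k p pd)).
  have := rnorm_coord (it k p - psi p) j; rewrite !mxE rdistC => /le_trans; apply.
  apply: le_trans (psiP p pd k) _; rewrite ltr_pdivlMr // in hk.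
  have hp : rnorm p * 2^-1 ^+ k <= d / 2 * 2^-1 ^+ k.
    by apply: ler_wpM2r (ltW pd); rewrite ltW // half_pow_gt0.
  clear -hp hk; lra.
have psi_fix w : rnorm w < d / 2 -> psi w = w + r (psi w).
  move=> wd; apply/eqP; rewrite -subr_eq0; apply/eqP/rnorm_small => e e0.
  have d2 : 0 < 2 * d by rewrite mulr_gt0 ?ltr0n.
  have [k hk] := half_pow_small (divr_gt0 e0 d2).
  have -> : psi w - (w + r (psi w)) = (psi w - it k.+1 w) + (r (it k w) - r (psi w)).
    have gen (x y s t : V) : x - (y + s) = (x - (y + t)) + (t - s).
      by rewrite !(opprD y) !(addrA x) subrKA.
    exact: gen.
  apply: le_trans (rnormD _ _) _; rewrite rdistC.
  have h1 := psiP w wd k.+1; have h2 := psiP w wd k; rewrite exprS in h1.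
  have l1 := it_le k w wd; have l2 := psi_le w wd.
  have h4 : rnorm (it k w) < d by clear -l1 wd; lra.
  have h5 : rnorm (psi w) < d by clear -l2 wd; lra.
  have h3 := rlip _ _ h5 h4.
  have hw : rnorm w * 2^-1 ^+ k <= d / 2 * 2^-1 ^+ k.
    by apply: ler_wpM2r (ltW wd); rewrite ltW // half_pow_gt0.
  rewrite (ltr_pdivlMr _ _ d2) in hk.
  have hd : 0 <= d * 2^-1 ^+ k by rewrite mulr_ge0 ?(ltW d0) // ltW // half_pow_gt0.
  clear -h1 h2 h3 hw hk hd.
  have h2' : rnorm (it k w - psi w) <= 2 * (rnorm w * 2^-1 ^+ k) by rewrite mulrA.
  lra.
have d20 : 0 < d / 2 by rewrite divr_gt0 ?ltr0n.
have psi0 : psi 0 = 0.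
  apply/eqP; rewrite -rnorm_eq0 eq_le rnorm_ge0 andbT.
  by have := psi_le 0; rewrite rnorm0 mulr0; apply.
suff H : biholomorphic_germ phi psi by exists psi.
split; first by split.
- by split => //; apply/nbhs0_rnormP; exists (d / 2).
- apply/nbhs0_rnormP; exists (d / 4); first by rewrite divr_gt0 ?ltr0n.
  move=> z zd; have phiE : phi z = z - r z by rewrite /r !fctE opprB addrC subrK.
  have rz := rle z ltac:(lra).
  have pz : rnorm (phi z) <= 3 / 2 * rnorm z.
    by rewrite phiE; apply: le_trans (rnormB _ _) _; lra.
  have := rnorm_ge0 z => zn.
  have wd : rnorm (phi z) < d / 2 by lra.
  have pl := psi_le _ wd.
  have lip := rlip z (psi (phi z)) ltac:(lra) ltac:(lra).
  have E : psi (phi z) - z = r (psi (phi z)) - r z.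
    by rewrite {1}(psi_fix _ wd) {1}phiE addrAC [z - _ - z]addrAC subrr add0r addrC.
  apply/eqP; rewrite -subr_eq0 -rnorm_eq0 eq_le rnorm_ge0 andbT.
  by rewrite -E in lip; lra.
apply/nbhs0_rnormP; exists (d / 2) => // w wd.
by rewrite -[RHS](addrK (r (psi w))) -psi_fix // /r !fctE opprB addrC subrK.
Qed.

End InverseFunction.

(** * Calculus of germs *)

Section Germs.
Variable R : realType.
Local Notation C := (Cx R).

Lemma near0W (V : normedModType C) (P : set V) :
  (forall z, P z) -> \forall z \near (0 : V), P z.
Proof. by move=> PT; exact: nearW. Qed.

Lemma near0I (V : normedModType C) (P Q : V -> Prop) :
  (\forall z \near (0 : V), P z) -> (\forall z \near (0 : V), Q z) ->
  \forall z \near (0 : V), P z /\ Q z.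
Proof. by apply: filterS2 => z. Qed.

Lemma near0_comp (V W : normedModType C) (g : V -> W) (P : set W) :
  differentiable g 0 -> g 0 = 0 -> (\forall w \near (0 : W), P w) ->
  \forall z \near (0 : V), P (g z).
Proof.
move=> dg g0 nP; have gc : g @ (0 : V) --> g 0 := differentiable_continuous dg.
by apply: (gc P); rewrite g0.
Qed.

Lemma differentiable_holo (V W : normedModType C) (f : V -> W) :
  (forall z, differentiable f z) -> holo f.
Proof. by move=> fd; exact: nearW. Qed.

Lemma holo0 (V W : normedModType C) (f : V -> W) : holo f -> differentiable f 0.
Proof. by move=> fh; exact: nbhs_singleton fh. Qed.

Lemma holo_comp (U V W : normedModType C) (g : V -> W) (f : U -> V) :
  holo f -> f 0 = 0 -> holo g -> holo (g \o f).
Proof.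
move=> fh f0 gh; have := near0_comp (holo0 fh) f0 gh.
by move: fh; apply: filterS2 => z df dg; exact: (differentiable_comp df dg).
Qed.

Section Holo.
Variable V : normedModType C.
Implicit Types f g : V -> C.

Lemma holo_cst (c : C) : holo (cst c : V -> C).
Proof. by apply: differentiable_holo => z; exact: differentiable_cst. Qed.

Lemma holoD f g : holo f -> holo g -> holo (fun z => f z + g z).
Proof. by apply: filterS2 => z df dg; exact: (differentiableD df dg). Qed.

Lemma holoB f g : holo f -> holo g -> holo (fun z => f z - g z).
Proof. by apply: filterS2 => z df dg; exact: (differentiableB df dg). Qed.

Lemma holoM f g : holo f -> holo g -> holo (fun z => f z * g z).
Proof. by apply: filterS2 => z df dg; exact: (differentiableM df dg). Qed.

Lemma holoX f k : holo f -> holo (fun z => f z ^+ k).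
Proof.
move=> fh; elim: k => [|k IH].
  have -> : (fun z => f z ^+ 0) = cst 1 by apply/funext => z; rewrite expr0.
  exact: holo_cst.
have -> : (fun z => f z ^+ k.+1) = (fun z => f z * f z ^+ k).
  by apply/funext => z; rewrite exprS.
exact: holoM.
Qed.

Lemma holo_sum (k : nat) (f : 'I_k -> V -> C) :
  (forall i, holo (f i)) -> holo (fun z => \sum_i f i z).
Proof.
move=> fh; elim: k f fh => [|k IH] f fh.
  have -> : (fun z => \sum_i f i z) = cst 0 by apply/funext => z; rewrite big_ord0.
  exact: holo_cst.
have -> : (fun z => \sum_i f i z) =
    (fun z => \sum_(i < k) f (widen_ord (leqnSn k) i) z + f ord_max z).
  by apply/funext => z; rewrite big_ord_recr.
by apply: holoD (fh _); exact: IH.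
Qed.

Lemma near_neq0 f : holo f -> f 0 != 0 -> \forall z \near (0 : V), f z != 0.
Proof.
move=> fh f0; have fc : f @ (0 : V) --> f 0 := differentiable_continuous (holo0 fh).
have fpos : 0 < `|f 0| by rewrite normr_gt0.
move/cvgrPdist_lt : fc => /(_ _ fpos); apply: filterS => z; apply: contraTneq => ->.
by rewrite subr0 ltxx.
Qed.

Lemma holoV f : holo f -> f 0 != 0 -> holo (fun z => (f z)^-1).
Proof.
move=> fh f0; have := near_neq0 fh f0; move: fh.
by apply: filterS2 => z df fz; exact: (differentiableV df fz).
Qed.
End Holo.

Lemma mulmx_differentiable k l (M : 'M[C]_(k, l)) z :
  differentiable (fun w : 'rV[C]_k => w *m M) z.
Proof.
apply: differentiable_row => j.
have -> : (fun w : 'rV[C]_k => (w *m M) 0 j : C) =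
    \sum_(i < k) (fun w : 'rV[C]_k => (w 0 i : C) * M i j).
  by apply/funext => w; rewrite mxE fct_sumE.
apply: differentiable_sum => i.
have dc := differentiable_coord z 0 i.
exact: (differentiableM dc (differentiable_cst (M i j) z)).
Qed.

Lemma holo_mulmx k l (M : 'M[C]_(k, l)) : holo (fun z : 'rV[C]_k => z *m M).
Proof. by apply: differentiable_holo => z; exact: mulmx_differentiable. Qed.

Lemma diff_mulmx k l (M : 'M[C]_(k, l)) z h :
  'd (fun w : 'rV[C]_k => w *m M) z h = h *m M.
Proof.
have c : continuous (mulmxr M : {linear 'rV[C]_k -> 'rV[C]_l}).
  by move=> w; exact: differentiable_continuous (mulmx_differentiable M w).
exact: (congr1 (fun f : 'rV[C]_k -> 'rV[C]_l => f h) (diff_lin z c)).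
Qed.

Lemma holo_coord N (i : 'I_N) : holo (fun z : 'rV[C]_N => z 0 i : C).
Proof. by apply: differentiable_holo => z; exact: differentiable_coord. Qed.

Lemma holo_scalel (V : normedModType C) (v : V) : holo (fun t : C => t *: v).
Proof.
by apply: differentiable_holo => t; exact: (ex_diff (is_diff_def := is_diff_scalel t v)).
Qed.

Lemma holo_entry (V : normedModType C) N (f : V -> 'rV[C]_N) j :
  holo f -> holo (fun z => f z 0 j : C).
Proof. by apply: filterS => z; exact: differentiable_entry. Qed.

Lemma holo_germ N (W : normedModType C) (f : 'rV[C]_N -> W) :
  holo f -> holomorphic_germ f.
Proof. by []. Qed.

(** Both sides are compared for t != 0 so that the identity can be divided by t in
    the induction; the constant coefficient is recovered by continuity at 0. *)
Lemma polynomial_flat (m : nat) (lam : 'I_m -> C) (w : C -> C) : holo w ->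
  (\forall t \near (0 : C), t != 0 -> \sum_k lam k * t ^+ k = t ^+ m * w t) ->
  forall k, lam k = 0.
Proof.
elim: m lam w => [|m IH] lam w wh eqn; first by case.
pose H (t : C) := (\sum_k lam k * t ^+ k) - t ^+ m.+1 * w t.
have idh : holo (id : C -> C) by apply: differentiable_holo => z; exact: ex_diff.
have Hh : holo H.
  apply: holoB; last by apply: holoM => //; exact: holoX.
  apply: holo_sum => k; apply: holoM; [exact: holo_cst|exact: holoX].
have H0 : H 0 = 0.
  apply: contrapT => /eqP H0; have [d d0 dP] := (nbhs0_rnormP _).1 (near_neq0 Hh H0).
  have [e e0 eP] := (nbhs0_rnormP _).1 eqn.
  pose t : C := rc (Num.min d e / 2).
  have t0 : 0 < Num.min d e by rewrite lt_min d0.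
  have tn : rnorm t = Num.min d e / 2 by rewrite rnorm_rc ger0_norm // ltW // divr_gt0.
  have tlt : rnorm t < Num.min d e by rewrite tn; lra.
  have tne : t != 0 by rewrite rc_eq0 gt_eqF // divr_gt0.
  move: tlt; rewrite lt_min => /andP[/dP/eqP td /eP te]; apply: td.
  by rewrite /H te // subrr.
have lam0 : lam ord0 = 0.
  move: H0; rewrite /H big_ord_recl expr0 mulr1 big1 => [|k _]; last first.
    by rewrite exprS mul0r mulr0.
  by rewrite addr0 exprS !mul0r subr0.
have lamS : forall k, lam (lift ord0 k) = 0.
  apply: (IH (fun k => lam (lift ord0 k)) w) => //; apply: filterS eqn => t tP t0.
  have := tP t0; rewrite big_ord_recl lam0 mul0r add0r => E.
  apply: (mulfI t0); rewrite mulrA -exprS -E mulr_sumr; apply: eq_bigr => k _.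
  by rewrite exprS mulrCA.
by move=> k; case: (unliftP ord0 k) => [j ->|->].
Qed.

End Germs.

(** * Ideals and dimensions of quotients *)

Section Quotients.
Variable R : realType.
Local Notation C := (Cx R).

Lemma in_ideal_sum n p (G : 'rV[C]_n -> 'rV[C]_p) k (v : 'I_k -> C)
    (a : 'I_k -> 'rV[C]_n -> C) :
  (forall i, in_ideal G (a i)) -> in_ideal G (fun z => \sum_i v i * a i z).
Proof.
move=> /choice[c cP]; exists (fun j z => \sum_i v i * c i j z); split.
  move=> j; apply/holo_germ/holo_sum => i; apply: holoM; first exact: holo_cst.
  by have [h _] := cP i; exact: h.
have : \forall z \near (0 : 'rV[C]_n), forall i, a i z = \sum_j c i j z * G z 0 j.
  by apply: (@filter_forall _ _ _ (nbhs (0 : 'rV[C]_n)) _) => i; have [_] := cP i.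
apply: filterS => z az; under eq_bigr => i _ do rewrite az mulr_sumr.
rewrite exchange_big /=; apply: eq_bigr => j _; rewrite mulr_suml.
by apply: eq_bigr => i _; rewrite mulrA.
Qed.

Lemma in_ideal_near n p (G : 'rV[C]_n -> 'rV[C]_p) a b :
  (\forall z \near (0 : 'rV[C]_n), a z = b z) -> in_ideal G a -> in_ideal G b.
Proof.
move=> ab [c [ch cE]]; exists c; split=> //.
by move: ab cE; apply: filterS2 => z <-.
Qed.

Lemma in_ideal_mulmx n p q (F : 'rV[C]_n -> 'rV[C]_p) (P : 'M[C]_(p, q)) a :
  in_ideal (fun z => F z *m P) a -> in_ideal F a.
Proof.
move=> [c [ch cE]]; exists (fun k z => \sum_j c j z * P k j); split.
  by move=> k; apply/holo_germ/holo_sum => j; apply: holoM; [exact: ch|exact: holo_cst].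
apply: filterS cE => z ->.
under eq_bigr => j _ do rewrite mxE mulr_sumr.
rewrite exchange_big /=; apply: eq_bigr => k _; rewrite mulr_suml.
by apply: eq_bigr => j _; rewrite -mulrA [P k j * _]mulrC.
Qed.

(** The ideal of F P is contained in that of F, so d elements that span modulo the
    former span modulo the latter, where the b i are independent. *)
Lemma quotient_dim_ge n p q (F : 'rV[C]_n -> 'rV[C]_p) (P : 'M[C]_(p, q))
    (m d : nat) (b : 'I_m -> 'rV[C]_n -> C) :
  (forall i, holomorphic_germ (b i)) ->
  (forall lam : 'I_m -> C, in_ideal F (fun z => \sum_i lam i * b i z) ->
     forall i, lam i = 0) ->
  quotient_dim (fun z => F z *m P) d -> (m <= d)%N.
Proof.
move=> bh bfree [e [eh espan _]]; rewrite leqNgt; apply/negP => dm.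
have /choice[M MP] : forall i : 'I_m, exists lam : 'I_d -> C,
    in_ideal F (fun z => b i z - \sum_j lam j * e j z).
  by move=> i; have [lam /in_ideal_mulmx h] := espan _ (bh i); exists lam.
pose A := \matrix_(i < m, j < d) M i j.
have kerA : kermx A != 0.
  rewrite -mxrank_eq0 mxrank_ker -lt0n subn_gt0.
  exact: leq_ltn_trans (rank_leq_col A) dm.
pose v := nz_row (kermx A).
have v0 : v != 0 by rewrite nz_row_eq0.
have vA : v *m A = 0 by apply/sub_kermxP; exact: nz_row_sub.
have /bfree vz : in_ideal F (fun z => \sum_i v 0 i * b i z).
  apply: in_ideal_near (in_ideal_sum (v 0) MP).
  apply: near0W => z; under eq_bigr => i _ do rewrite mulrBr mulr_sumr.
  rewrite sumrB exchange_big /= [X in _ - X]big1 ?subr0 // => j _.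
  under eq_bigr => i _ do rewrite mulrA.
  rewrite -mulr_suml; have := congr1 (fun B : 'rV[C]_d => B 0 j) vA.
  rewrite mxE [RHS]mxE => E; rewrite (_ : \sum_i _ = 0) ?mul0r // -[RHS]E.
  by apply: eq_bigr => i _; rewrite mxE.
by case/eqP: v0; apply/rowP => i; rewrite vz mxE.
Qed.

End Quotients.

(** * Multiplicity and generic degree of a normal form *)

Section NormalForm.
Variables (R : realType) (n m : nat).
Local Notation C := (Cx R).
Variables (g h : 'rV[C]_n.+1 -> C).
Local Notation V := 'rV[C]_n.+1.
Local Notation F := (normal_form m g h).

Definition axis : V := delta_mx 0 ord_max.
Definition axis_p (t : C) : C := t ^+ m + g (t *: axis).
Definition axis_q (t : C) : C := h (t *: axis).

Hypotheses (m_gt0 : (0 < m)%N) (gh : holo g) (hh : holo h).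
Hypothesis p_low : forall j, (j < m)%N -> iter j (@dquot R) axis_p 0 = 0.
Hypothesis q_low : forall j, (j < m)%N -> iter j (@dquot R) axis_q 0 = 0.
Hypothesis p_order : iter m (@dquot R) axis_p 0 != 0.

Let p (z : V) : C := z 0 ord_max ^+ m + g z.
Let unit_p := iter m (@dquot R) axis_p.

Lemma axis_last (t : C) : (t *: axis) 0 ord_max = t.
Proof. by rewrite !mxE !eqxx mulr1. Qed.

Lemma axis_low (t : C) (i : 'I_n) : (t *: axis) 0 (widen_ord (leqnSn n) i) = 0.
Proof.
rewrite !mxE (_ : widen_ord _ i == ord_max = false) ?andbF ?mulr0 //.
by rewrite -val_eqE /= ltn_eqF.
Qed.

Lemma clear_below_axis (z : V) : clear_below n z = z 0 ord_max *: axis.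
Proof.
apply/rowP => j; rewrite !mxE /= -val_eqE /=.
have := ltn_ord j; rewrite ltnS leq_eqVlt => /orP[/eqP jn|jn].
  by rewrite jn ltnn eqxx mulr1; congr (z 0 _); exact: val_inj.
by rewrite jn ltn_eqF // mulr0.
Qed.

Lemma holo_p : holo p.
Proof. by apply: holoD gh; apply: holoX; exact: holo_coord. Qed.

Lemma holo_axis (a : V -> C) : holo a -> holo (fun t : C => a (t *: axis)).
Proof. by move=> ah; apply: holo_comp (holo_scalel axis) _ ah; rewrite scale0r. Qed.

Lemma holo_axis_p : holo axis_p.
Proof.
have -> : axis_p = (fun t => p (t *: axis)).
  by apply/funext => t; rewrite /axis_p /p axis_last.
exact: holo_axis holo_p.
Qed.

Lemma holo_last (w : C -> C) : holo w -> holo (fun z : V => w (z 0 ord_max)).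
Proof.
have z0 : (0 : V) 0 ord_max = 0 by rewrite mxE.
by move=> wh; exact: (holo_comp (@holo_coord R n.+1 ord_max) z0 wh).
Qed.

Lemma axis_pE t : axis_p t = t ^+ m * unit_p t.
Proof.
rewrite {1}(taylor_dquot m axis_p t) big1 ?add0r // => j _.
by rewrite p_low ?mul0r.
Qed.

Lemma axis_qE t : axis_q t = t ^+ m * iter m (@dquot R) axis_q t.
Proof.
rewrite {1}(taylor_dquot m axis_q t) big1 ?add0r // => j _.
by rewrite q_low ?mul0r.
Qed.

Lemma normal_form_low (z : V) (j : 'I_n.+2) : (j < n)%N -> F z 0 j = z 0 (inord j).
Proof. by move=> jn; rewrite mxE jn. Qed.

Lemma normal_form_p (z : V) (j : 'I_n.+2) : j = n :> nat -> F z 0 j = p z.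
Proof. by move=> jn; rewrite mxE jn ltnn eqxx. Qed.

Lemma normal_form_q (z : V) : F z 0 ord_max = h z.
Proof. by rewrite mxE /= ltnNge leqnSn /= gtn_eqF. Qed.

Lemma normal_form_sum (c : 'I_n.+2 -> C) (z : V) :
  \sum_j c j * F z 0 j =
  \sum_(i < n) c (widen_ord (leqW (leqnSn n)) i) * z 0 (widen_ord (leqnSn n) i)
  + c (widen_ord (leqnSn n.+1) ord_max) * p z + c ord_max * h z.
Proof.
rewrite big_ord_recr big_ord_recr /= normal_form_q normal_form_p //.
congr (_ + _ + _); apply: eq_bigr => i _; rewrite normal_form_low //=.
congr (c _ * z 0 _); apply: val_inj => //=.
by rewrite inordK // ltnS ltnW.
Qed.

Lemma map_germ_normal_form : map_germ F.
Proof.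
split.
  have : \forall z \near (0 : V), differentiable p z /\ differentiable h z.
    by move: holo_p hh; apply: filterS2.
  apply: filterS => z [dp dh]; apply: differentiable_row => j.
  have [jn|jn] := boolP (j < n)%N.
    have -> : (fun w => F w 0 j : C) = (fun w : V => w 0 (inord j) : C).
      by apply/funext => w; rewrite normal_form_low.
    exact: differentiable_coord.
  have [jn'|jn'] := eqVneq (j : nat) n.
    have -> : (fun w => F w 0 j : C) = p.
      by apply/funext => w; rewrite normal_form_p.
    exact: dp.
  have -> : (fun w => F w 0 j : C) = h.
    by apply/funext => w; rewrite mxE (negbTE jn) (negbTE jn').
  exact: dh.
have z0 : (0 : V) = 0 *: axis by rewrite scale0r.
have p0 : p 0 = 0.
  have := axis_pE 0; rewrite /axis_p scale0r expr0n eqn0Ngt m_gt0 mul0r.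
  by rewrite /p mxE expr0n eqn0Ngt m_gt0.
have h0 : h 0 = 0.
  by have := axis_qE 0; rewrite /axis_q scale0r expr0n eqn0Ngt m_gt0 mul0r.
apply/rowP => j; rewrite [RHS]mxE; have [jn|jn] := boolP (j < n)%N.
  by rewrite normal_form_low // mxE.
have [jn'|jn'] := eqVneq (j : nat) n; first by rewrite normal_form_p.
by rewrite mxE (negbTE jn) (negbTE jn').
Qed.

Lemma finite_normal_form : finite_germ F.
Proof.
have [_ F0] := map_germ_normal_form.
have uh : holo unit_p by apply: iter_dquot_holo; exact: holo_axis_p.
have := near_neq0 (holo_last uh); rewrite mxE => /(_ p_order).
apply: filterS => z uz; split=> [Fz|->]; last exact: F0.
have zax : z = z 0 ord_max *: axis.
  rewrite -clear_below_axis; apply/rowP => j; rewrite mxE; case: ifP => // jn.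
  have jn2 : (j < n.+2)%N by rewrite ltnW // ltnS ltnW // ltnW.
  have := congr1 (fun B : 'rV[C]_n.+2 => B 0 (Ordinal jn2)) Fz.
  rewrite normal_form_low //= [RHS]mxE => <-; congr (z 0 _).
  by apply: val_inj; rewrite /= inordK.
have : p z = 0.
  have := congr1 (fun B : 'rV[C]_n.+2 => B 0 (widen_ord (leqnSn n.+1) ord_max)) Fz.
  by rewrite normal_form_p // mxE.
rewrite zax /p axis_last -/(axis_p _) axis_pE => /eqP.
rewrite mulf_eq0 (negbTE uz) orbF expf_eq0 m_gt0 /= => /eqP ->.
by rewrite scale0r.
Qed.

(** On the y-axis, a = sum of lam k y^k + y^m b(y) and p = y^m unit_p(y), so the
    term y^m b(y) is (b / unit_p) p there.  Off the axis both a and p differ from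
    their restrictions by combinations of the x_i. *)
Lemma normal_form_span (a : V -> C) : holo a ->
  exists (lam : 'I_m -> C) (c : 'I_n.+1 -> V -> C) (u : V -> C),
    [/\ forall i, holo (c i), holo u &
    \forall z \near (0 : V), a z - \sum_k lam k * z 0 ord_max ^+ k =
      \sum_(i < n) c (widen_ord (leqnSn n) i) z * z 0 (widen_ord (leqnSn n) i)
      + u z * p z].
Proof.
move=> ah.
have [c [ch cE]] := hadamard (leqnSn n) ah.
have [d [dh dE]] := hadamard (leqnSn n) holo_p.
pose A (t : C) := a (t *: axis).
have Ah : holo A := holo_axis ah.
have uh : holo unit_p by apply: iter_dquot_holo; exact: holo_axis_p.
pose u (z : V) := iter m (@dquot R) A (z 0 ord_max) * (unit_p (z 0 ord_max))^-1.
have u0 : unit_p ((0 : V) 0 ord_max) != 0 by rewrite mxE.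
have uholo : holo u.
  apply: holoM; first by apply: (holo_last (iter_dquot_holo m Ah)).
  exact: holoV (holo_last uh) u0.
exists (fun k => iter k (@dquot R) A 0).
exists (fun i z => c i z - u z * d i z), u.
split=> //; first by move=> i; apply/holo_germ/holoB => //; exact: holoM.
apply: filterS (near_neq0 (holo_last uh) u0) => z uz.
have sumE (b : 'I_n.+1 -> V -> C) : \sum_(i < n.+1 | (i < n)%N) z 0 i * b i z =
    \sum_(i < n) b (widen_ord (leqnSn n) i) z * z 0 (widen_ord (leqnSn n) i).
  rewrite big_mkcond big_ord_recr /= ltnn addr0; apply: eq_bigr => i _.
  by rewrite ltn_ord mulrC.
have pz : p z = z 0 ord_max ^+ m * unit_p (z 0 ord_max) +
    \sum_(i < n) d (widen_ord (leqnSn n) i) z * z 0 (widen_ord (leqnSn n) i).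
  by rewrite dE sumE clear_below_axis /p axis_last -/(axis_p _) axis_pE.
rewrite cE sumE clear_below_axis -/(A _) [A _](taylor_dquot m A).
rewrite pz.
under [in RHS]eq_bigr => i _ do rewrite mulrBl -mulrA.
rewrite sumrB -mulr_sumr /u; field.
by [].
Qed.

(** On the y-axis the x_i vanish and y^m divides the last two components of F. *)
Lemma normal_form_free (lam : 'I_m -> C) :
  in_ideal F (fun z => \sum_k lam k * z 0 ord_max ^+ k) -> forall k, lam k = 0.
Proof.
move=> [c [ch cE]].
pose w t := c (widen_ord (leqnSn n.+1) ord_max) (t *: axis) * unit_p t
            + c ord_max (t *: axis) * iter m (@dquot R) axis_q t.
have uh : holo unit_p by apply: iter_dquot_holo; exact: holo_axis_p.
have vh : holo (iter m (@dquot R) axis_q) by apply: iter_dquot_holo; exact: holo_axis hh.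
apply: (@polynomial_flat _ _ _ w).
  by apply: holoD; apply: holoM => //; apply: holo_axis; exact: ch.
have := near0_comp (holo0 (holo_scalel axis)) (scale0r axis) cE.
apply: filterS => t tE _; rewrite axis_last in tE; rewrite tE normal_form_sum.
rewrite big1 => [|i _]; last first.
  by rewrite axis_low mulr0.
rewrite add0r /p axis_last -/(axis_p _) -/(axis_q _) axis_pE axis_qE /w; ring.
Qed.

(** The coefficients of the components x_1, ..., x_n, p and q of F, the last one
    being 0, indexed by the position of the component. *)
Definition generator_coef (c : 'I_n.+1 -> V -> C) (u : V -> C) (j : nat) : V -> C :=
  if (j < n)%N then c (inord j) else if j == n then u else cst 0.

Lemma generator_coef_holo c u j : (forall i, holo (c i)) -> holo u ->
  holo (generator_coef c u j).
Proof.
move=> ch uh; rewrite /generator_coef; case: ifP => _; first exact: ch.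
by case: ifP => _; [exact: uh|exact: holo_cst].
Qed.

Lemma generator_coef_low c u (i : 'I_n) :
  generator_coef c u i = c (widen_ord (leqnSn n) i).
Proof.
rewrite /generator_coef ltn_ord; congr (c _); apply: val_inj => /=.
by rewrite inordK // ltnS ltnW.
Qed.

Lemma generator_coef_p c u : generator_coef c u n = u.
Proof. by rewrite /generator_coef ltnn eqxx. Qed.

Lemma generator_coef_q c u : generator_coef c u n.+1 = cst 0.
Proof. by rewrite /generator_coef ltnNge leqnSn /= gtn_eqF. Qed.

Lemma multiplicity_normal_form : multiplicity F m.
Proof.
exists (fun k z => z 0 ord_max ^+ k); split; last exact: normal_form_free.
  by move=> k; apply/holo_germ/holoX; exact: holo_coord.
move=> a ah; have [lam [c [u [ch uh cE]]]] := normal_form_span ah.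
exists lam, (fun j : 'I_n.+2 => generator_coef c u j); split.
  by move=> j; apply/holo_germ/generator_coef_holo.
apply: filterS cE => z ->; rewrite normal_form_sum /=.
rewrite generator_coef_p generator_coef_q mul0r addr0; congr (_ + _).
by apply: eq_bigr => i _; rewrite generator_coef_low.
Qed.

Lemma projected_normal_form (z : V) (j : 'I_n.+1) :
  (F z *m (pid_mx n.+1 : 'M[C]_(n.+2, n.+1))) 0 j = F z 0 (widen_ord (leqnSn n.+1) j).
Proof.
rewrite mxE (bigD1 (widen_ord (leqnSn n.+1) j)) //= [X in _ + X]big1 ?addr0.
  by rewrite [pid_mx _ _ _]mxE /= eqxx ltn_ord mulr1.
move=> k kj; rewrite [pid_mx _ _ _]mxE (_ : (k == j :> nat) = false) ?mulr0 //.
by apply: contra_neqF kj => /eqP kj; exact: val_inj.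
Qed.

(** The projection to the first n+1 components keeps x and p, and these are the
    only components used in [normal_form_span]. *)
Lemma generic_degree_normal_form : generic_degree F m.
Proof.
split; last first.
  move=> P d _; apply: (@quotient_dim_ge _ _ _ _ _ _ _ _ (fun k z => z 0 ord_max ^+ k)).
    by move=> k; apply/holo_germ/holoX; exact: holo_coord.
  exact: normal_form_free.
exists (pid_mx n.+1); split; first by rewrite rank_pid_mx.
exists (fun k z => z 0 ord_max ^+ k); split.
- by move=> k; apply/holo_germ/holoX; exact: holo_coord.
- move=> a ah; have [lam [c [u [ch uh cE]]]] := normal_form_span ah.
  exists lam, (fun j : 'I_n.+1 => generator_coef c u j); split.
    by move=> j; apply/holo_germ/generator_coef_holo.
  apply: filterS cE => z ->; rewrite big_ord_recr /=; congr (_ + _).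
    apply: eq_bigr => i _; rewrite projected_normal_form normal_form_low //=.
    rewrite generator_coef_low; congr (_ * z 0 _); apply: val_inj => /=.
    by rewrite inordK // ltnS ltnW.
  by rewrite projected_normal_form normal_form_p //= generator_coef_p.
by move=> lam /in_ideal_mulmx; exact: normal_form_free.
Qed.

End NormalForm.

(** * Reduction of a corank 1 germ to a normal form *)

Section Reduction.
Variables (R : realType) (n : nat).
Local Notation C := (Cx R).
Local Notation V := 'rV[C]_n.+1.
Local Notation W := 'rV[C]_n.+2.

Lemma linear_map_germ k (M : 'M[C]_k) : map_germ (fun z : 'rV[C]_k => z *m M).
Proof. by split; [exact/holo_germ/holo_mulmx|rewrite mul0mx]. Qed.

Lemma map_germ_comp j k l (f : 'rV[C]_j -> 'rV[C]_k) (g : 'rV[C]_k -> 'rV[C]_l) :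
  map_germ f -> map_germ g -> map_germ (g \o f).
Proof.
move=> [fh f0] [gh g0]; split; last by rewrite /= f0.
exact/holo_germ/(holo_comp fh f0 gh).
Qed.

Lemma near0_map j k (f : 'rV[C]_j -> 'rV[C]_k) (P : set 'rV[C]_k) : map_germ f ->
  (\forall z \near (0 : 'rV[C]_k), P z) -> \forall z \near (0 : 'rV[C]_j), P (f z).
Proof. by move=> [fh f0]; exact: (near0_comp (holo0 fh) f0). Qed.

Lemma biholomorphic_mulmx k (M : 'M[C]_k) : M \in unitmx ->
  biholomorphic_germ (fun z : 'rV[C]_k => z *m M) (fun z => z *m invmx M).
Proof.
move=> Mu; split; try exact: linear_map_germ.
  by apply: near0W => z; rewrite mulmxK.
by apply: near0W => z; rewrite mulmxKV.
Qed.

Lemma biholomorphic_comp k (f f' g g' : 'rV[C]_k -> 'rV[C]_k) :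
  biholomorphic_germ f f' -> biholomorphic_germ g g' ->
  biholomorphic_germ (g \o f) (f' \o g').
Proof.
move=> [fg f'g ff ff'] [gg g'g gg1 gg'].
split; [exact: map_germ_comp|exact: map_germ_comp| |].
  have h := near0_map fg gg1.
  by move: h ff; apply: filterS2 => z /= ->.
have h := near0_map g'g ff'.
by move: h gg'; apply: filterS2 => z /= ->.
Qed.

Lemma jacobian_rank_normal (f : V -> W) : corank f = 1%N ->
  exists (A : 'M[C]_n.+1) (B : 'M[C]_n.+2), [/\ A \in unitmx, B \in unitmx &
    forall h, 'd f 0 (h *m A) *m B = h *m pid_mx n].
Proof.
rewrite /corank; set J := 'J f _ => rJ.
have rk : \rank J = n by have := subnK (rank_leq_row J); rewrite rJ add1n => -[].
exists (invmx (col_ebase J)), (invmx (row_ebase J)).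
split; rewrite ?unitmx_inv ?col_ebase_unit ?row_ebase_unit // => h.
have -> : 'd f 0 (h *m invmx (col_ebase J)) = h *m invmx (col_ebase J) *m J.
  by rewrite /J /jacobian mul_rV_lin1.
rewrite -{2}(mulmx_ebase J) rk !mulmxA mulmxKV ?col_ebase_unit //.
by rewrite mulmxK ?row_ebase_unit.
Qed.

(** The first n components of f1 = B o f o A have linear parts x_1, ..., x_n, so
    together with y they form a map phi tangent to the identity; composing with
    its inverse turns these components into coordinates. *)
Lemma straighten (f : V -> W) : map_germ f -> corank f = 1%N ->
  exists (A : 'M[C]_n.+1) (B : 'M[C]_n.+2) (phi psi : V -> V),
  [/\ A \in unitmx, B \in unitmx, biholomorphic_germ phi psi &
   \forall z \near (0 : V), forall j : 'I_n.+1, (j < n)%N ->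
     (f (psi z *m A) *m B) 0 (widen_ord (leqnSn n.+1) j) = z 0 j].
Proof.
move=> fg fc; have [A [B [Au Bu dAB]]] := jacobian_rank_normal fc.
pose f1 (z : V) : W := f (z *m A) *m B.
have f1g : map_germ f1.
  have h := map_germ_comp (linear_map_germ A) fg.
  have Bg : map_germ (fun z : W => z *m B) := linear_map_germ B.
  exact: (map_germ_comp h Bg).
have df1 h : 'd f1 0 h = h *m pid_mx n.
  have dA := mulmx_differentiable A (0 : V).
  have df : differentiable f (0 *m A) by rewrite mul0mx; exact: holo0 fg.1.
  have dfA : differentiable (f \o (fun z : V => z *m A)) 0 := differentiable_comp dA df.
  have dB := mulmx_differentiable B (f (0 *m A)).
  have e1 : 'd f1 0 h = 'd (fun z : W => z *m B) (f (0 *m A))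
      ('d (f \o (fun z : V => z *m A)) 0 h).
    exact: (congr1 (fun k : V -> W => k h) (diff_comp dfA dB)).
  have e2 : 'd (f \o (fun z : V => z *m A)) 0 h =
      'd f (0 *m A) ('d (fun z : V => z *m A) 0 h).
    exact: (congr1 (fun k : V -> W => k h) (diff_comp dA df)).
  by rewrite e1 e2 diff_mulmx diff_mulmx mul0mx dAB.
pose phi (z : V) : V :=
  \row_j if (j < n)%N then f1 z 0 (widen_ord (leqnSn n.+1) j) else z 0 j.
have phiE j : (fun w => phi w 0 j : C) =
    if (j < n)%N then (fun w => f1 w 0 (widen_ord (leqnSn n.+1) j) : C)
    else (fun w : V => w 0 j : C).
  by apply/funext => w; rewrite mxE; case: ifP.
have phi_diff z : differentiable f1 z -> differentiable phi z.
  move=> d1; apply: differentiable_row => j; rewrite phiE.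
  case: ifP => _; last exact: differentiable_coord.
  exact: (differentiable_entry (widen_ord (leqnSn n.+1) j) d1).
have phig : map_germ phi.
  split; first by apply: filterS f1g.1 => z; exact: phi_diff.
  by apply/rowP => j; rewrite mxE [RHS]mxE f1g.2; case: ifP => _; rewrite mxE.
have d10 : differentiable f1 0 := holo0 f1g.1.
have dphi h : 'd phi 0 h = h.
  apply/rowP => j; rewrite -(diff_entry j h (phi_diff 0 d10)) phiE.
  case: ifP => jn.
    rewrite (diff_entry (widen_ord (leqnSn n.+1) j) h d10) df1 mxE (bigD1 j) //=.
    rewrite [X in _ + X]big1 => [|k kj].
      by rewrite mxE /= eqxx jn mulr1 addr0.
    rewrite mxE (_ : (k == _ :> nat) = false) ?mulr0 //=.
    by apply: contra_neqF kj => /eqP kj; exact: val_inj.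
  have idd : differentiable (id : V -> V) 0 by exact: ex_diff.
  have := diff_entry j h idd => ->.
  by rewrite (diff_val (is_diff_def := is_diff_id (0 : V))).
have [psi phipsi] := inverse_function phig dphi.
exists A, B, phi, psi; split=> //.
have [_ _ _ ] := phipsi; apply: filterS => z zE j jn.
by have := congr1 (fun v : V => v 0 j) zE; rewrite mxE jn.
Qed.

(** m is the least order of vanishing of the two functions at 0; one of the orders
    is finite by [holo_identity]. *)
Lemma order_pair (P Q : C -> C) : holo P -> holo Q ->
  ~ (\forall t \near (0 : C), P t = 0 /\ Q t = 0) ->
  exists m, ((iter m (@dquot R) P 0 != 0) || (iter m (@dquot R) Q 0 != 0)) /\
    forall j, (j < m)%N -> iter j (@dquot R) P 0 = 0 /\ iter j (@dquot R) Q 0 = 0.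
Proof.
move=> Ph Qh nz.
have ex : exists m, (iter m (@dquot R) P 0 != 0) || (iter m (@dquot R) Q 0 != 0).
  apply: contrapT => none; apply: nz.
  have all0 j : iter j (@dquot R) P 0 = 0 /\ iter j (@dquot R) Q 0 = 0.
    have : ~~ ((iter j (@dquot R) P 0 != 0) || (iter j (@dquot R) Q 0 != 0)).
      by apply/negP => h; apply: none; exists j.
    by rewrite negb_or !negbK => /andP[/eqP -> /eqP ->].
  have P0 := holo_identity Ph (fun j => (all0 j).1).
  have Q0 := holo_identity Qh (fun j => (all0 j).2).
  by move: P0 Q0; apply: filterS2.
case: (ex_minnP ex) => m mP mmin; exists m; split=> // j jm.
have : ~~ ((iter j (@dquot R) P 0 != 0) || (iter j (@dquot R) Q 0 != 0)).
  by apply: contraL jm => /mmin; rewrite leqNgt.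
by rewrite negb_or !negbK => /andP[/eqP -> /eqP ->].
Qed.

(** Otherwise f would vanish along the curve that corresponds to the y-axis,
    against finiteness. *)
Lemma axis_components_nonzero (f : V -> W) (A : 'M[C]_n.+1) (B : 'M[C]_n.+2)
    (phi psi : V -> V) (ip iq : 'I_n.+2) :
  finite_germ f -> A \in unitmx -> B \in unitmx -> biholomorphic_germ phi psi ->
  (forall j : 'I_n.+2, [\/ (j < n)%N, j = ip | j = iq]) ->
  (\forall z \near (0 : V), forall j : 'I_n.+1, (j < n)%N ->
     (f (psi z *m A) *m B) 0 (widen_ord (leqnSn n.+1) j) = z 0 j) ->
  ~ (\forall t \near (0 : C), (f (psi (t *: axis R n) *m A) *m B) 0 ip = 0 /\
                             (f (psi (t *: axis R n) *m A) *m B) 0 iq = 0).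
Proof.
move=> ffin Au Bu [phig psig _ phipsi] cover low nz.
have axh : holo (fun t : C => t *: axis R n) := holo_scalel (axis R n).
have near_axis (P : set V) : (\forall z \near (0 : V), P z) ->
    \forall t \near (0 : C), P (t *: axis R n).
  exact: (near0_comp (holo0 axh) (scale0r (axis R n))).
have fA := near_axis _ (near0_map (map_germ_comp psig (linear_map_germ A)) ffin).
have lowt := near_axis _ low; have inv := near_axis _ phipsi.
have [d d0 dP] : exists2 d : R, 0 < d & forall t : C, rnorm t < d -> t = 0.
  have [d d0 dP] := (nbhs0_rnormP _).1 (near0I (near0I fA lowt) (near0I inv nz)).
  exists d => // t /dP[[ft lowt'] [inv' [tp tq]]].
  have z0 : f (psi (t *: axis R n) *m A) = 0.
    suff v0 : f (psi (t *: axis R n) *m A) *m B = 0.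
      by have := mulmxK Bu (f (psi (t *: axis R n) *m A)); rewrite v0 mul0mx.
    apply/rowP => j; rewrite [RHS]mxE.
    case: (cover j) => [jn|->|->]; [|exact: tp|exact: tq].
    have jn1 : (j < n.+1)%N by rewrite ltnW.
    have := lowt' (Ordinal jn1) jn.
    have -> : widen_ord (leqnSn n.+1) (Ordinal jn1) = j by exact: val_inj.
    move=> ->; have -> : Ordinal jn1 = widen_ord (leqnSn n) (Ordinal jn) by exact: val_inj.
    exact: axis_low.
  have psi0 : psi (t *: axis R n) = 0.
    have psiA : psi (t *: axis R n) *m A = 0 := ft.1 z0.
    by have := mulmxK Au (psi (t *: axis R n)); rewrite psiA mul0mx.
  by rewrite -(axis_last n t) -inv' psi0 phig.2 mxE.
have t0 : rc (d / 2) = 0 by apply: dP; rewrite rnorm_rc ger0_norm; lra.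
by move/eqP: t0; rewrite rc_eq0 gt_eqF // divr_gt0.
Qed.

End Reduction.

Section Assembly.
Variables (R : realType) (n : nat).
Local Notation C := (Cx R).
Local Notation V := 'rV[C]_n.+1.
Local Notation W := 'rV[C]_n.+2.

Lemma A_equivalent_straightened (f F : V -> W) (A : 'M[C]_n.+1) (D : 'M[C]_n.+2)
    (phi psi : V -> V) :
  A \in unitmx -> D \in unitmx -> biholomorphic_germ phi psi ->
  (\forall z \near (0 : V), F z = f (psi z *m A) *m D) -> A_equivalent f F.
Proof.
move=> Au Du phipsi FE.
have iAu : invmx A \in unitmx by rewrite unitmx_inv.
have := biholomorphic_comp (biholomorphic_mulmx iAu) phipsi; rewrite invmxK.
move=> bih; exists (phi \o (mulmx^~ (invmx A))), ((mulmx^~ A) \o psi).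
by exists (mulmx^~ D), (mulmx^~ (invmx D)); split=> //; exact: biholomorphic_mulmx.
Qed.

(** The pair of components without linear part is brought into the right order by a
    transposition, which is absorbed in D. *)
Lemma choose_order (f : V -> W) : map_germ f -> finite_germ f -> corank f = 1%N ->
  exists (A : 'M[C]_n.+1) (D : 'M[C]_n.+2) (phi psi : V -> V) (m : nat),
  let F0 z := f (psi z *m A) *m D in
  let ip := widen_ord (leqnSn n.+1) ord_max in
  [/\ A \in unitmx, D \in unitmx, biholomorphic_germ phi psi &
   [/\ \forall z \near (0 : V), forall j : 'I_n.+2, (j < n)%N -> F0 z 0 j = z 0 (inord j),
       iter m (@dquot R) (fun t => F0 (t *: axis R n) 0 ip) 0 != 0 &
       forall j, (j < m)%N ->
         iter j (@dquot R) (fun t => F0 (t *: axis R n) 0 ip) 0 = 0 /\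
         iter j (@dquot R) (fun t => F0 (t *: axis R n) 0 ord_max) 0 = 0]].
Proof.
move=> fg ffin fc; have [A [B [phi [psi [Au Bu bih low]]]]] := straighten fg fc.
have [phig psig _ _] := bih.
pose ip : 'I_n.+2 := widen_ord (leqnSn n.+1) ord_max.
pose F1 (z : V) : W := f (psi z *m A) *m B.
have F1g : map_germ F1.
  have h1 := map_germ_comp (map_germ_comp psig (linear_map_germ A)) fg.
  exact: (map_germ_comp h1 (linear_map_germ B)).
have axh i : holo (fun t : C => F1 (t *: axis R n) 0 i : C).
  exact: (holo_axis (holo_entry i F1g.1)).
have cover (j : 'I_n.+2) : [\/ (j < n)%N, j = ip | j = ord_max].
  have := ltn_ord j; rewrite ltnS leq_eqVlt => /orP[/eqP jn|].
    by apply: Or33; exact: val_inj.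
  rewrite ltnS leq_eqVlt => /orP[/eqP jn|jn]; last by apply: Or31.
  by apply: Or32; exact: val_inj.
have nz := axis_components_nonzero ffin Au Bu bih cover low.
have [m [mP mlow]] := order_pair (axh ip) (axh ord_max) nz.
(* s exchanges the last two components exactly when the first of them has
   larger order than the second. *)
have [s [s_low sP]] : exists s : {perm 'I_n.+2}, (forall j : 'I_n.+2, (j < n)%N -> s j = j) /\
    ((s ip = ip /\ s ord_max = ord_max /\
       iter m (@dquot R) (fun t => F1 (t *: axis R n) 0 ip) 0 != 0) \/
     (s ip = ord_max /\ s ord_max = ip /\
       iter m (@dquot R) (fun t => F1 (t *: axis R n) 0 ord_max) 0 != 0)).
  case/orP: mP => h; first by exists 1%g; split; [move=> *|left]; rewrite !perm1.
  exists (tperm ip ord_max); split; last by right; rewrite tpermL tpermR.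
  move=> j jn; rewrite tpermD // -val_eqE /= gtn_eqF //.
  by rewrite ltnW // ltnS.
pose D := B *m perm_mx s^-1.
have DE (z : V) j : (f (psi z *m A) *m D) 0 j = F1 z 0 (s j).
  by rewrite /D mulmxA -col_permE mxE.
exists A, D, phi, psi, m => F0; split=> //.
  by rewrite unitmx_mul Bu unitmx_perm.
have FE i : (fun t => F0 (t *: axis R n) 0 i) = (fun t => F1 (t *: axis R n) 0 (s i)).
  by apply/funext => t; exact: DE.
split.
- apply: filterS low => z lowz j jn; rewrite /F0 DE s_low //.
  have jn1 : (j < n.+1)%N by rewrite ltnW.
  have := lowz (Ordinal jn1) jn.
  have -> : widen_ord (leqnSn n.+1) (Ordinal jn1) = j by exact: val_inj.
  by move=> E; rewrite [LHS]E; congr (z 0 _); apply: val_inj; rewrite /= inordK.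
- by rewrite FE; case: sP => [[-> [_ ]]|[-> [_ ]]].
move=> j /mlow[P0 Q0]; rewrite !FE; case: sP => [[-> [-> _]]|[-> [-> _]]]; by split.
Qed.

End Assembly.

Unset Implicit Arguments.

Theorem lemma3p2 (R : realType) (n : nat)
    (f : 'rV[Cx R]_n.+1 -> 'rV[Cx R]_n.+2)
    (f_germ : map_germ f) (f_finite : finite_germ f)
    (f_corank : corank f = 1%N) :
  exists (m : nat) (g h : 'rV[Cx R]_n.+1 -> Cx R),
    [/\ (0 < m)%N, holomorphic_germ g & holomorphic_germ h] /\
    [/\ map_germ (normal_form m g h),
        finite_germ (normal_form m g h),
        A_equivalent f (normal_form m g h) &
        exists d : nat, multiplicity (normal_form m g h) d /\
                        generic_degree (normal_form m g h) d].
Proof.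
have [A [D [phi [psi [m [Au Du bih [low p_order p_low]]]]]]] :=
  choose_order f_germ f_finite f_corank.
have [phig psig _ _] := bih.
pose F0 (z : 'rV[Cx R]_n.+1) := f (psi z *m A) *m D.
pose ip : 'I_n.+2 := widen_ord (leqnSn n.+1) ord_max.
have F0g : map_germ F0.
  have h1 := map_germ_comp (map_germ_comp psig (linear_map_germ A)) f_germ.
  exact: (map_germ_comp h1 (linear_map_germ D)).
pose g (z : 'rV[Cx R]_n.+1) : Cx R := F0 z 0 ip - z 0 ord_max ^+ m.
pose h (z : 'rV[Cx R]_n.+1) : Cx R := F0 z 0 ord_max.
have gh : holo g.
  apply: holoB; first exact: (holo_entry ip F0g.1).
  by apply: holoX; exact: holo_coord.
have hh : holo h := holo_entry ord_max F0g.1.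
have pE : axis_p m g = fun t => F0 (t *: axis R n) 0 ip.
  by apply/funext => t; rewrite /axis_p /g axis_last addrC subrK.
have qE : axis_q h = fun t => F0 (t *: axis R n) 0 ord_max by [].
have m_gt0 : (0 < m)%N.
  by case: (m) p_order => //=; rewrite scale0r -/(F0 0) F0g.2 mxE eqxx.
have pl j : (j < m)%N -> iter j (@dquot R) (axis_p m g) 0 = 0.
  by move=> /p_low[h0 _]; rewrite pE.
have ql j : (j < m)%N -> iter j (@dquot R) (axis_q h) 0 = 0.
  by move=> /p_low[_ h0]; rewrite qE.
have po : iter m (@dquot R) (axis_p m g) 0 != 0 by rewrite pE.
exists m, g, h; split; first by split.
split.
- exact: map_germ_normal_form.
- exact: finite_normal_form.
- apply: (A_equivalent_straightened Au Du bih).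
  apply: filterS low => z lowz; apply/rowP => j; rewrite mxE.
  case: ifP => [jn|/negbT jn]; first by rewrite lowz.
  case: eqP => [jn'|jn'].
    by rewrite /g addrC subrK /F0; congr (_ 0 _); exact: val_inj.
  rewrite /h /F0; congr (_ 0 _); apply: val_inj => /=.
  have := ltn_ord j; rewrite ltnS leq_eqVlt => /orP[/eqP -> //|].
  by rewrite ltnS leq_eqVlt (negbTE jn) orbF => /eqP.
exists m; split; first exact: multiplicity_normal_form.
exact: generic_degree_normal_form.
Qed.
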